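(* Let $A$ be an $m$-Koszul Artin--Schelter regular algebra, generated in degree $1$, of Gorenstein parameter $\ell$ and of global dimension and GK dimension $d$. Write $V=A_1$ and $A=\mathscr{D}(\mathsf{w},\ell-m)$ for a twisted superpotential $\mathsf{w}\in V^{\otimes \ell}$. Let $H$ be a semisimple Hopf algebra such that $A$ is a left $H$-module algebra, each $A_i$ is an $H$-submodule of $A$, and the action of $H$ on $A$ is inner-faithful. Then $\Bbbk\mathsf{w}$ is an $H$-submodule of $V^{\otimes\ell}$, and the homological determinant $\operatorname{hdet}_A:H\to\Bbbk$ of the action of $H$ on $A$ satisfies $$h\cdot \mathsf{w}=\operatorname{hdet}_A(h)\,\mathsf{w}\qquad\text{for all } h\in H.$$
   Context: $\Bbbk$ is an algebraically closed field of characteristic $0$; unadorned tensor products are over $\Bbbk$; $\Delta(h)=h_{(1)}\otimes h_{(2)}$, $\varepsilon$, $S$ denote coproduct, counit, antipode. Semisimple Hopf algebras are finite-dimensional with $S^2=\mathrm{id}$. AS regular: a connected graded $\Bbbk$-algebra $A$ ($\mathbb{N}$-graded, $A_0=\Bbbk$) is AS regular of dimension $d$ with Gorenstein parameter $\ell$ if its left and right injective dimensions equal $d<\infty$; $\operatorname{Ext}^i_A({}_A\Bbbk,{}_AA)$ is $0$ for $i\ne d$ and is $\Bbbk[\ell]$ (graded shift, $M[\ell]_n=M_{\ell+n}$) for $i=d$, and symmetrically on the right with the same $\ell$; $A$ has global dimension $d$; and $A$ has finite GK dimension. $m$-Koszul: $A=T_\Bbbk(V)/\langle\mathcal R\rangle$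 with $V=A_1$ finite-dimensional and $\mathcal R\subseteq V^{\otimes m}$, and the $m$-Koszul complex of $A$ is exact; equivalently $\operatorname{Tor}_i^A(\Bbbk,\Bbbk)$ is concentrated in degree $\rho(i)$ for all $i$, where $\rho(i)=mi/2$ for $i$ even and $\rho(i)=m(i-1)/2+1$ for $i$ odd. Twisted superpotential: let $\theta:V^{\otimes \ell}\to V^{\otimes\ell}$, $\theta(u_1\otimes\cdots\otimes u_\ell)=u_2\otimes\cdots\otimes u_\ell\otimes u_1$. $\mathsf w\in V^{\otimes\ell}$ is a twisted superpotential if $(\mathrm{id}^{\otimes(\ell-1)}\otimes\sigma)\theta(\mathsf w)=\mathsf w$ for some $\sigma\in \mathrm{GL}(V)$. Derivation-quotient algebra: $\mathscr D(\mathsf w,i)=T_\Bbbk(V)/\langle\partial^i\mathsf w\rangle$, where $\partial^i\mathsf w=\{(\psi_1\otimes\cdots\otimes\psi_i\otimes\mathrm{id}^{\otimes(\ell-i)})(\mathsf w)\mid\psi_j\in V^*\}$. Every $m$-Koszul AS regular algebra of Gorenstein parameter $\ell$ is of the form $\mathscr D(\mathsf w,\ell-m)$ for some twisted superpotential $\mathsf w\in V^{\otimes\ell}$ (a known theorem of Dubois-Violette). $A$ is a left $H$-module algebra if it is a left $H$-module with $h\cdot(ab)=(h_{(1)}\cdot a)(h_{(2)}\cdot b)$ and $h\cdot 1=\varepsilon(h)1$. $H$ acts on $V^{\otimes \ell}$ diagonally via the coproduct. The action on a module $V$ is inner-faithful if $IV\neq0$ for every nonzero Hopf ideal $I$ of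 $H$. Homological determinant: viewing $\Bbbk$ as a left module over the smash product $A\# H$ and taking a graded projective resolution of it over $A\# H$ (which is an $H$-equivariant graded projective $A$-resolution), $\operatorname{Ext}^d_A(\Bbbk,\Bbbk)$ becomes a one-dimensional left $H$-module; so $h\cdot x=\eta(h)x$ for an algebra map $\eta:H\to\Bbbk$. Then $\operatorname{hdet}_A=\eta\circ S$. (The smash product $A\# H$ is $A\otimes H$ with $(a\# h)(b\# k)=a(h_{(1)}\cdot b)\# h_{(2)}k$.) *)

(* Defs.v *)
From HB Require Import structures.
From mathcomp Require Import all_boot all_order all_algebra all_field.
Set Implicit Arguments.
Unset Strict Implicit.
Unset Printing Implicit Defensive.
Import GRing.Theory.
Local Open Scope ring_scope.

Definition in_span (k : fieldType) (M : lmodType k) (S : M -> Prop) (x : M) : Prop :=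
  exists n (c : 'I_n -> k) (y : 'I_n -> M),
    (forall j, S (y j)) /\ x = \sum_j c j *: y j.

Definition has_dim (k : fieldType) (M : lmodType k) (U : M -> Prop) (n : nat) : Prop :=
  exists b : 'I_n -> M, (forall i, U (b i)) /\
    forall x, U x -> exists! c : {ffun 'I_n -> k}, x = \sum_i c i *: b i.

(* A direct sum decomposition of M is encoded by its family of projections;   *)
(* x is homogeneous of degree i iff pr i x = x.                               *)
Definition is_grading (k : fieldType) (I : eqType) (M : lmodType k)
    (pr : I -> M -> M) : Prop :=
  [/\ forall i, linear (pr i),
      forall i j x, pr i (pr j x) = if i == j then pr j x else 0
    & forall x, exists2 s : seq I, uniq s & x = \sum_(i <- s) pr i x].

(* X (x) U for a finite-dimensional U: the family t stands for                *)
(* \sum_j t j (x) e_j, where e is the chosen basis vbasis {:U} of U.          *)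
Notation tens X U := {ffun 'I_(\dim {:U}) -> X}.

Definition pure (k : fieldType) (X : lmodType k) (U : vectType k) (x : X) (u : U)
  : tens X U := [ffun j => coord (vbasis {:U}) j u *: x].

(* The linear map induced on X (x) U by a bilinear map beta; in particular    *)
(* tens_lift (fun h1 h2 => E) (coprod h) is the Sweedler sum of E over        *)
(* h_(1) (x) h_(2).                                                           *)
Definition tens_lift (k : fieldType) (X : lmodType k) (U : vectType k)
    (Y : lmodType k) (beta : X -> U -> Y) (t : tens X U) : Y :=
  \sum_j beta (t j) (vbasis {:U})`_j.

Definition tensv (k : fieldType) (X U : vectType k) (I : {vspace X}) (J : {vspace U})
  : {vspace tens X U} := <<[seq pure x u | x <- vbasis I, u <- vbasis J]>>%VS.

Record hopfAlg (k : fieldType) := HopfAlg {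
  hopf_sort :> falgType k;
  coprod : hopf_sort -> tens hopf_sort hopf_sort;
  counit : hopf_sort -> k;
  antip : hopf_sort -> hopf_sort;
  _ : linear coprod;
  _ : scalar counit;
  _ : linear antip;
  _ : forall h, (* coassociativity, in (H (x) H) (x) H *)
        tens_lift (fun h1 h2 => tens_lift (fun h11 h12 =>
          pure (pure h11 h12) h2) (coprod h1)) (coprod h) =
        tens_lift (fun h1 h2 => tens_lift (fun h21 h22 =>
          pure (pure h1 h21) h22) (coprod h2)) (coprod h);
  _ : forall h, tens_lift (fun h1 h2 => counit h1 *: h2) (coprod h) = h;
  _ : forall h, tens_lift (fun h1 h2 => counit h2 *: h1) (coprod h) = h;
  _ : coprod 1 = pure 1 1;
  _ : forall g h, coprod (g * h) =
        tens_lift (fun g1 g2 => tens_lift (fun h1 h2 =>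
          pure (g1 * h1) (g2 * h2)) (coprod h)) (coprod g);
  _ : counit 1 = 1;
  _ : forall g h, counit (g * h) = counit g * counit h;
  _ : forall h, tens_lift (fun h1 h2 => antip h1 * h2) (coprod h) = counit h *: 1;
  _ : forall h, tens_lift (fun h1 h2 => h1 * antip h2) (coprod h) = counit h *: 1
}.

Definition left_ideal (k : fieldType) (H : falgType k) (I : {vspace H}) : Prop :=
  forall h x, x \in I -> h * x \in I.

Definition right_ideal (k : fieldType) (H : falgType k) (I : {vspace H}) : Prop :=
  forall h x, x \in I -> x * h \in I.

Definition semisimple (k : fieldType) (H : falgType k) : Prop :=
  forall I : {vspace H}, left_ideal I ->
  exists J : {vspace H},
    [/\ left_ideal J, (I + J)%VS = fullv & (I :&: J)%VS = 0%VS].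

Definition hopf_ideal (k : fieldType) (H : hopfAlg k) (I : {vspace H}) : Prop :=
  [/\ left_ideal I, right_ideal I,
      forall x, x \in I -> coprod x \in (tensv I fullv + tensv fullv I)%VS,
      forall x, x \in I -> counit x = 0
    & forall x, x \in I -> antip x \in I].

(* cg_aug is the augmentation A -> A_0 = k. *)
Record cgAlg (k : fieldType) := CgAlg {
  cg_sort :> algType k;
  cg_pr : nat -> cg_sort -> cg_sort;
  cg_aug : cg_sort -> k;
  _ : is_grading cg_pr;
  _ : forall i j a b, cg_pr i a = a -> cg_pr j b = b -> cg_pr (i + j)%N (a * b) = a * b;
  _ : cg_pr 0%N 1 = 1;
  _ : forall a, cg_pr 0%N a = cg_aug a *: 1
}.

Definition module_algebra (k : fieldType) (H : hopfAlg k) (A : algType k)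
    (act : H -> A -> A) : Prop :=
  (forall h, linear (act h)) /\ (forall a, linear (act^~ a)) /\
  (forall g h a, act (g * h) a = act g (act h a)) /\
  (forall a, act 1 a = a) /\
  (forall h a b, act h (a * b) =
     tens_lift (fun h1 h2 => act h1 a * act h2 b) (coprod h)) /\
  (forall h, act h 1 = counit h *: 1).

Definition graded_action (k : fieldType) (H : hopfAlg k) (A : cgAlg k)
    (act : H -> A -> A) : Prop :=
  forall i h a, cg_pr i a = a -> cg_pr i (act h a) = act h a.

Definition inner_faithful (k : fieldType) (H : hopfAlg k) (A : lmodType k)
    (act : H -> A -> A) : Prop :=
  forall I : {vspace H}, hopf_ideal I -> I != 0%VS ->
  exists2 h, h \in I & exists a, act h a != 0.

(* ralg and rmod carry the data only, and is_mod states the module axioms:    *)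
(* this lets A, its opposite and the smash product A # H share one theory.    *)
Record ralg (k : fieldType) := RAlg {
  ra_sort :> lmodType k;
  ra_mul : ra_sort -> ra_sort -> ra_sort;
  ra_one : ra_sort;
  ra_pr : nat -> ra_sort -> ra_sort
}.

Definition alg_left (k : fieldType) (A : cgAlg k) : ralg k :=
  RAlg (fun a b : A => a * b) 1 (@cg_pr k A).

Definition alg_right (k : fieldType) (A : cgAlg k) : ralg k :=
  RAlg (fun a b : A => b * a) 1 (@cg_pr k A).

Definition smash (k : fieldType) (A : cgAlg k) (H : hopfAlg k) (act : H -> A -> A)
  : ralg k :=
  @RAlg k (tens A H)
    (fun s t =>
       tens_lift (fun a h => tens_lift (fun b g => tens_lift (fun h1 h2 =>
         pure (a * act h1 b) (h2 * g)) (coprod h)) t) s)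
    (pure (1 : A) (1 : H))
    (fun n s => [ffun j => cg_pr n (s j)]).

Record rmod (k : fieldType) (B : ralg k) := RMod {
  rm_sort :> lmodType k;
  rm_act : B -> rm_sort -> rm_sort;
  rm_pr : int -> rm_sort -> rm_sort
}.

(* The flag gr selects the category: Z-graded modules and degree-preserving   *)
(* maps if gr = true; all modules and all module maps if gr = false, in which *)
(* case rm_pr plays no role.                                                  *)
Definition is_mod (k : fieldType) (B : ralg k) (gr : bool) (M : rmod B) : Prop :=
  [/\ (forall b, linear (rm_act (r := M) b)) /\
      (forall x : M, linear (fun b => rm_act b x)),
      forall b c (x : M), rm_act (ra_mul b c) x = rm_act b (rm_act c x),
      forall x : M, rm_act (ra_one B) x = x
    & gr -> is_grading (@rm_pr k B M) /\
        forall (i : nat) (j : int) b (x : M),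
          ra_pr i b = b -> rm_pr j x = x ->
          rm_pr (i%:Z + j) (rm_act b x) = rm_act b x].

Definition is_hom (k : fieldType) (B : ralg k) (gr : bool) (M N : rmod B)
    (f : M -> N) : Prop :=
  [/\ linear f, forall b x, f (rm_act b x) = rm_act b (f x)
    & gr -> forall n x, f (rm_pr n x) = rm_pr n (f x)].

Definition is_hom_deg (k : fieldType) (B : ralg k) (n : int) (M N : rmod B)
    (f : M -> N) : Prop :=
  is_hom false f /\ forall j x, f (rm_pr j x) = rm_pr (j + n) (f x).

Definition surj (X Y : Type) (f : X -> Y) : Prop := forall y, exists x, f x = y.

Definition projective (k : fieldType) (B : ralg k) (gr : bool) (P : rmod B) : Prop :=
  forall (M N : rmod B) (g : M -> N) (f : P -> N),
    is_mod gr M -> is_mod gr N -> is_hom gr g -> surj g -> is_hom gr f ->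
    exists2 f' : P -> M, is_hom gr f' & forall x, g (f' x) = f x.

Definition injective_mod (k : fieldType) (B : ralg k) (gr : bool) (Q : rmod B) : Prop :=
  forall (M N : rmod B) (g : M -> N) (f : M -> Q),
    is_mod gr M -> is_mod gr N -> is_hom gr g -> injective g -> is_hom gr f ->
    exists2 f' : N -> Q, is_hom gr f' & forall x, f' (g x) = f x.

Record chain (k : fieldType) (B : ralg k) := Chain {
  ch_mod :> nat -> rmod B;
  ch_d : forall i, ch_mod i.+1 -> ch_mod i
}.

Record cochain (k : fieldType) (B : ralg k) := Cochain {
  coch_mod :> nat -> rmod B;
  coch_d : forall i, coch_mod i -> coch_mod i.+1
}.

Definition is_proj_res (k : fieldType) (B : ralg k) (gr : bool) (M : rmod B)
    (P : chain B) : Prop :=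
  [/\ forall i, is_mod gr (P i) /\ projective gr (P i),
      forall i, is_hom gr (ch_d (c := P) (i := i)),
      exists e : P 0%N -> M, [/\ is_hom gr e, surj e
        & forall x, e x = 0 <-> exists y, x = ch_d y]
    & forall i (x : P i.+1), ch_d x = 0 <-> exists y, x = ch_d y].

Definition is_inj_res (k : fieldType) (B : ralg k) (gr : bool) (M : rmod B)
    (Q : cochain B) : Prop :=
  [/\ forall i, is_mod gr (Q i) /\ injective_mod gr (Q i),
      forall i, is_hom gr (coch_d (c := Q) (i := i)),
      exists e : M -> Q 0%N, [/\ is_hom gr e, injective e
        & forall x, coch_d x = 0 <-> exists y, x = e y]
    & forall i (x : Q i.+1), coch_d x = 0 <-> exists y, x = coch_d y].

Definition pdim_le (k : fieldType) (B : ralg k) (M : rmod B) (n : nat) : Prop :=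
  exists2 P : chain B, is_proj_res false M P &
    forall i, (n < i)%N -> forall x : P i, x = 0.

Definition idim_le (k : fieldType) (B : ralg k) (M : rmod B) (n : nat) : Prop :=
  exists2 Q : cochain B, is_inj_res false M Q &
    forall i, (n < i)%N -> forall x : Q i, x = 0.

Definition idim_eq (k : fieldType) (B : ralg k) (M : rmod B) (n : nat) : Prop :=
  idim_le M n /\ forall n', idim_le M n' -> (n <= n')%N.

Definition gldim_eq (k : fieldType) (B : ralg k) (n : nat) : Prop :=
  (forall M : rmod B, is_mod false M -> pdim_le M n) /\
  forall n', (forall M : rmod B, is_mod false M -> pdim_le M n') -> (n <= n')%N.

Definition regular_mod (k : fieldType) (B : ralg k) : rmod B :=
  @RMod k B B (@ra_mul k B)
    (fun n => if n is Posz i then ra_pr i else fun=> 0).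

(* The one-dimensional module on which B acts through chi, in degree 0. *)
Definition char_mod (k : fieldType) (B : ralg k) (chi : B -> k) : rmod B :=
  @RMod k B k^o (fun b c => chi b * c) (fun n c => if n == 0 then c else 0).

(* Cohomology of Hom(P, N), where isC says which maps P_i -> N are cochains.  *)
Section Cohomology.
Context (k : fieldType) (B : ralg k) (P : chain B) (N : rmod B)
        (isC : forall M : rmod B, (M -> N) -> Prop).

Definition cocycle i (f : P i -> N) : Prop :=
  isC f /\ forall x, f (ch_d x) = 0.

Definition coboundary i : (P i -> N) -> Prop :=
  match i return (P i -> N) -> Prop with
  | 0%N => fun f => forall x, f x = 0
  | j.+1 => fun f => exists2 g : P j -> N, isC g & forall x, f x = g (ch_d x)
  end.

Definition cohom_zero i : Prop := forall f : P i -> N, cocycle f -> coboundary f.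

Definition cohom_one_dim i : Prop :=
  exists f0 : P i -> N, [/\ cocycle f0, ~ coboundary f0
    & forall f : P i -> N, cocycle f ->
        exists c : k, coboundary (fun x => f x - c *: f0 x)].
End Cohomology.

(* Ext^i_B(k, B), graded by the degree n of the cochains, is 0 for i <> d and *)
(* k[l] for i = d.  Since k[l]_n = k_(l+n), the latter lives in degree -l.    *)
Definition ext_gorenstein (k : fieldType) (B : ralg k) (aug : B -> k) (d l : nat) : Prop :=
  forall P : chain B, is_proj_res true (char_mod aug) P ->
  forall (i : nat) (n : int),
    let isC := fun (M : rmod B) (f : M -> regular_mod B) => is_hom_deg n f in
    if (i == d) && (n == - l%:Z) then cohom_one_dim P isC i else cohom_zero P isC i.

(* The span of the products of at most n factors from X is the n-th power of  *)
(* the finite-dimensional subspace spanned by 1 and X.                        *)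
Definition growth (k : fieldType) (A : algType k) (X : seq A) (n D : nat) : Prop :=
  has_dim (in_span (fun a => exists s : seq A,
    [/\ {subset s <= X}, (size s <= n)%N & a = \prod_(y <- s) y])) D.

(* GKdim A is the supremum, over the finite-dimensional subspaces <1, X>, of  *)
(* limsup_n log_n dim <1, X>^n; below, log_n D <= p / q is D ^ q <= n ^ p.    *)
Definition gkdim_le (k : fieldType) (A : algType k) (d : nat) : Prop :=
  forall (X : seq A) (p q : nat), (0 < q)%N -> (d * q < p)%N ->
  exists n0, forall n D, (n0 <= n)%N -> growth X n D -> (D ^ q <= n ^ p)%N.

Definition gkdim_ge (k : fieldType) (A : algType k) (d : nat) : Prop :=
  forall p q : nat, (0 < q)%N -> (p < d * q)%N ->
  exists X : seq A, forall n0, exists n D,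
    [/\ (n0 <= n)%N, growth X n D & (n ^ p <= D ^ q)%N].

Definition gkdim_eq (k : fieldType) (A : algType k) (d : nat) : Prop :=
  gkdim_le A d /\ gkdim_ge A d.

Definition AS_regular (k : fieldType) (A : cgAlg k) (d l : nat) : Prop :=
  (idim_eq (regular_mod (alg_left A)) d /\ idim_eq (regular_mod (alg_right A)) d) /\
  (ext_gorenstein (B := alg_left A) (@cg_aug k A) d l /\
   ext_gorenstein (B := alg_right A) (@cg_aug k A) d l) /\
  (gldim_eq (alg_left A) d /\ gldim_eq (alg_right A) d) /\
  (exists e : nat, gkdim_le A e).

(* V has basis x_0, ..., x_(N-1), and the function F in                       *)
(* tpow X N n stands for the element \sum_t F t (x) x_(t_1) (x) ... (x)       *)
(* x_(t_n) of X (x) V^{(x) n}.                                                *)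
Notation tpow X N n := {ffun n.-tuple 'I_N -> X}.

(* The coefficient of the word s, which is 0 if s does not have length n.     *)
Definition tcoef (X : nmodType) N n (F : tpow X N n) (s : seq 'I_N) : X :=
  if insub s is Some t then F t else 0.

(* F (x) G in V^{(x) n}, to be used with n = p + q. *)
Definition tmul (k : fieldType) N p q n (F : tpow k^o N p) (G : tpow k^o N q)
  : tpow k^o N n :=
  [ffun t : n.-tuple 'I_N => tcoef F (take p t) * tcoef G (drop p t)].

(* f_1 (x) ... (x) f_n, where f i x_b = \sum_a (f i) a b x_a. *)
Definition tmap (k : fieldType) N n (f : 'I_n -> 'M[k]_N) (F : tpow k^o N n)
  : tpow k^o N n :=
  [ffun t => \sum_(s : n.-tuple 'I_N)
     (\prod_i f i (tnth t i) (tnth s i)) * F s].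

Section Presentations.
Context (k : fieldType) (N m : nat) (R : tpow k^o N m -> Prop).

(* The elements a (x) r (x) b with a in V^{(x) i}, r in R, b in V^{(x) j}. *)
Definition sandwich i j n (G : tpow k^o N n) : Prop :=
  exists (a : tpow k^o N i) (r : tpow k^o N m) (b : tpow k^o N j),
    R r /\ G = tmul n a (tmul (m + j) r b).

(* The degree n part of the ideal <R> of T(V). *)
Definition ideal_deg n : tpow k^o N n -> Prop :=
  in_span (fun G => exists i j, (i + m + j)%N = n /\ sandwich i j G).

(* W_n = \bigcap_(i + m + j = n) V^{(x) i} (x) R (x) V^{(x) j}; this is all   *)
(* of V^{(x) n} if n < m.                                                     *)
Definition koszul_space n (F : tpow k^o N n) : Prop :=
  forall i j, (i + m + j)%N = n -> in_span (sandwich i j (n := n)) F.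

Context (A : cgAlg k) (x : 'I_N -> A).

Definition wprod (s : seq 'I_N) : A := \prod_(i <- s) x i.

Definition teval n (F : tpow k^o N n) : A :=
  \sum_(t : n.-tuple 'I_N) F t *: wprod t.

(* A = T(V) / <R> as graded algebras, through x. *)
Definition presents : Prop :=
  (forall n a, cg_pr n a = a -> exists F : tpow k^o N n, a = teval F) /\
  (forall n (F : tpow k^o N n), teval F = 0 <-> ideal_deg F).

Definition rho i : nat := if odd i then (m * i./2 + 1)%N else (m * i./2)%N.

(* F lies in A (x) W_(rho i). *)
Definition in_koszul i (F : tpow A N (rho i)) : Prop :=
  exists n (a : 'I_n -> A) (g : 'I_n -> tpow k^o N (rho i)),
    (forall j, koszul_space (g j)) /\ F = [ffun t => \sum_j g j t *: a j].

(* a (x) v_1...v_p |-> a v_1...v_(p-q) (x) v_(p-q+1)...v_p, with              *)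
(* p = rho (i+1) and q = rho i.                                               *)
Definition koszul_d i (F : tpow A N (rho i.+1)) : tpow A N (rho i) :=
  [ffun t : (rho i).-tuple 'I_N =>
     \sum_(s : (rho i.+1 - rho i).-tuple 'I_N) tcoef F (s ++ t) * wprod s].

(* Exactness of ... -> A (x) W_(rho 2) -> A (x) W_(rho 1) -> A -> k -> 0.     *)
Definition koszul_exact : Prop :=
  (forall F : tpow A N (rho 0), cg_aug (tcoef F [::]) = 0 ->
     exists2 G, in_koszul G & F = koszul_d (i := 0%N) G) /\
  (forall i (F : tpow A N (rho i.+1)), in_koszul F -> koszul_d F = 0 ->
     exists2 G, in_koszul G & F = koszul_d (i := i.+1) G).
End Presentations.

Definition deg1_basis (k : fieldType) (A : cgAlg k) N (x : 'I_N -> A) : Prop :=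
  (forall i, cg_pr 1%N (x i) = x i) /\
  forall a, cg_pr 1%N a = a -> exists! c : {ffun 'I_N -> k}, a = \sum_i c i *: x i.

Definition m_Koszul (k : fieldType) (A : cgAlg k) N (x : 'I_N -> A) (m : nat) : Prop :=
  (1 < m)%N /\
  exists R : tpow k^o N m -> Prop, presents R x /\ koszul_exact R x.

(* theta (u_1 (x) ... (x) u_l) = u_2 (x) ... (x) u_l (x) u_1. *)
Definition theta (k : fieldType) N l (w : tpow k^o N l) : tpow k^o N l :=
  [ffun t : l.-tuple 'I_N => w [tuple of rotr 1 t]].

Definition twisted_superpotential (k : fieldType) N l (w : tpow k^o N l) : Prop :=
  exists2 sigma : 'M[k]_N, sigma \in unitmx &
    tmap (fun i : 'I_l => if i.+1 == l then sigma else 1%:M) (theta w) = w.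

(* The set of all (psi_1 (x) ... (x) psi_i (x) id)(w), with psi_j in V^*      *)
(* given by its values on the basis.                                          *)
Definition partials (k : fieldType) N l (w : tpow k^o N l) (i : nat)
    (G : tpow k^o N (l - i)) : Prop :=
  exists psi : 'I_i -> 'I_N -> k,
    G = [ffun t : (l - i).-tuple 'I_N => \sum_(s : i.-tuple 'I_N)
           (\prod_j psi j (tnth s j)) * tcoef w (s ++ t)].

Definition derivation_quotient (k : fieldType) (A : cgAlg k) N (x : 'I_N -> A)
    l (w : tpow k^o N l) (i : nat) : Prop :=
  presents (@partials k N l w i) x.

(* rho_V h is the matrix of h acting on V: h x_b = \sum_a (rho_V h) a b x_a.  *)
(* diag_entry h t s is the coefficient of the word t in h applied to the word *)
(* s, computed from h (v (x) u) = h_(1) v (x) h_(2) u and h 1 = counit h.     *)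
Fixpoint diag_entry (k : fieldType) (H : hopfAlg k) N (rho_V : H -> 'M[k]_N)
    (h : H) (t s : seq 'I_N) : k^o :=
  match t, s with
  | [::], [::] => counit h
  | a :: t', b :: s' =>
      tens_lift (fun h1 h2 => rho_V h1 a b *: diag_entry rho_V h2 t' s') (coprod h)
  | _, _ => 0
  end.

Definition diag_act (k : fieldType) (H : hopfAlg k) N (rho_V : H -> 'M[k]_N) n
    (h : H) (F : tpow k^o N n) : tpow k^o N n :=
  [ffun t : n.-tuple 'I_N =>
     \sum_(s : n.-tuple 'I_N) diag_entry rho_V h t s * F s].

Section Hdet.
Context (k : fieldType) (A : cgAlg k) (H : hopfAlg k) (act : H -> A -> A).

Definition smash_aug (s : smash act) : k :=
  tens_lift (Y := k^o) (fun (a : A) (h : H) => cg_aug a * counit h) s.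

Definition restrict_alg (M : rmod (smash act)) : rmod (alg_left A) :=
  @RMod k (alg_left A) M (fun a => rm_act (pure (a : A) (1 : H) : smash act))
    (@rm_pr k (smash act) M).

Definition restrict_chain (P : chain (smash act)) : chain (alg_left A) :=
  @Chain k (alg_left A) (fun i => restrict_alg (P i)) (fun i => @ch_d k _ P i).

(* P is a graded projective A # H-resolution of k, so that Hom_A(P, k)        *)
(* computes Ext_A(k, k).  For left A # H-modules M and M', H acts on          *)
(* Hom_A(M, M') by (h f)(x) = h_(2) f(S^-1(h_(1)) x).  For M' = k and         *)
(* S^2 = id (which holds for semisimple H in characteristic 0) this is        *)
(* (h f)(x) = f(S(h) x).                                                      *)
Definition is_hdet (d : nat) (hdet : H -> k) : Prop :=
  exists2 P : chain (smash act), is_proj_res true (char_mod smash_aug) P &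
  let PA := restrict_chain P in
  let kA : rmod (alg_left A) := char_mod (B := alg_left A) (@cg_aug k A) in
  let isC := fun (M : rmod (alg_left A)) (f : M -> kA) => is_hom false f in
  cohom_one_dim PA isC d /\
  exists2 eta : H -> k,
    forall (h : H) (f : P d -> kA), cocycle (P := PA) isC f ->
      coboundary (P := PA) (i := d) isC
        (fun x : P d => f (rm_act (pure (1 : A) (antip h) : smash act) x) - eta h *: f x)
  & forall h, hdet h = eta (antip h).
End Hdet.

(* Main.v *)
(* Write W_n for the intersection of the V^{(x) i} (x) R (x) V^{(x) j} with   *)
(* i + m + j = n. The A # H-modules A (x) W_(rho i) form the Koszul complex,  *)
(* a minimal free A-resolution of k. Since gldim A = d, minimality gives      *)
(* W_(rho (d+1)) = 0, and the Gorenstein condition then forces rho d = l and  *)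
(* dim W_l = 1. The twisted superpotential w is a nonzero element of W_l,     *)
(* which is H-stable; hence h w = lambda(h) w for a character lambda of H.    *)
(* An A # H-projective resolution P of k maps to the Koszul complex, and the  *)
(* class of Ext^d(k, k) given by a linear form on W_l pulls back to a         *)
(* nonzero class on P. Comparing the actions gives eta = lambda o S, so       *)
(* hdet = lambda o S o S, and this is lambda because lambda o S is the        *)
(* convolution inverse of lambda.                                             *)

From HB Require Import structures.
Require Import Defs.
From mathcomp Require Import all_boot all_order all_algebra all_field.
From Stdlib Require Import ClassicalEpsilon.
Set Implicit Arguments.
Unset Strict Implicit.
Unset Printing Implicit Defensive.
Import GRing.Theory.
Local Open Scope ring_scope.

(** Everything is read off from the Koszul complex K with terms A (x) W_(rho i), and two features of
    K do the work. First, W_n can be recognised inside A: a tensor lies in W_n exactly when all its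
    slices of length m evaluate to 0 ([koszul_spaceP]). Hence H preserves W_n ([W_diag_act]), K is a
    complex of A # H-modules, and the presentation of A by [w] can be compared with the one that
    makes A m-Koszul. Second, K is free and minimal over A: A-linear maps from K to k vanish on
    boundaries ([koszul_minimal]). So every linear form on W_(rho i) is a cocycle, and its pullback
    along a comparison map from another resolution is a coboundary only if the form is 0
    ([minimal_pullback]).

    Finite global dimension gives W_(rho (d+1)) = 0 ([koszul_rank_gt]), and the Gorenstein condition
    then fixes rho d = l and dim W_l = 1 ([koszul_rank_top]). The twist symmetry puts [w] in W_l
    ([superpotential_slices]), and [w] is not 0, since otherwise A would have no relations and W_l
    would vanish ([superpotential_neq0]). So [w] spans W_l and H acts on it by a character lambda
    ([top_character]).

    For an A # H-projective resolution P of k, projectivity of P gives an A # H-linear comparison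
    map phi from P to K, and projectivity of K over A gives an A-linear map back. Let f be the
    coordinate form on W_l. As phi is H-linear, S(h) multiplies f phi by lambda(S(h)); by definition
    of eta it also multiplies it by eta(h), up to a coboundary. The injectivity above gives eta =
    lambda o S ([top_hdet]), and hdet = lambda o S o S is lambda by uniqueness of convolution
    inverses ([character_antip2]). *)

Section LinearFunctions.
Context (k : fieldType) (U V : lmodType k) (f : U -> V) (fL : linear f).

Definition as_linear : {linear U -> V} :=
  HB.pack f (GRing.isLinear.Build k U V *:%R f fL).

Lemma lin_sum I (r : seq I) (P : pred I) (E : I -> U) :
  f (\sum_(i <- r | P i) E i) = \sum_(i <- r | P i) f (E i).
Proof. exact: (linear_sum as_linear). Qed.

Lemma lin0 : f 0 = 0. Proof. exact: (linear0 as_linear). Qed.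

Lemma linD u v : f (u + v) = f u + f v. Proof. exact: (linearD as_linear). Qed.

Lemma linB u v : f (u - v) = f u - f v. Proof. exact: (linearB as_linear). Qed.

Lemma linZ a u : f (a *: u) = a *: f u. Proof. exact: (linearZ_LR as_linear). Qed.

End LinearFunctions.

Lemma linear_comp (k : fieldType) (U V W : lmodType k) (f : V -> W) (g : U -> V) :
  linear f -> linear g -> linear (fun u => f (g u)).
Proof. by move=> fL gL a u v; rewrite gL fL. Qed.

Lemma linear_sumf (k : fieldType) (U V : lmodType k) I (r : seq I) (P : pred I)
  (f : I -> U -> V) :
  (forall i, linear (f i)) -> linear (fun u => \sum_(i <- r | P i) f i u).
Proof.
move=> fL a u v; rewrite scaler_sumr -big_split /=.
by apply: eq_bigr => i _; rewrite fL.
Qed.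

Lemma linear_scalef (k : fieldType) (U V : lmodType k) (c : k) (f : U -> V) :
  linear f -> linear (fun u => c *: f u).
Proof. by move=> fL a u v; rewrite fL scalerDr !scalerA mulrC. Qed.

Lemma linear_scale (k : fieldType) (U : lmodType k) (c : k) :
  linear (fun u : U => c *: u).
Proof. by move=> a u v; rewrite scalerDr !scalerA mulrC. Qed.

Lemma linear_scalel (k : fieldType) (U : lmodType k) (z : U) :
  linear (fun c : k^o => @GRing.scale k U c z).
Proof. by move=> a u v; rewrite scalerDl -scalerA. Qed.

Lemma linear_subf (k : fieldType) (U V : lmodType k) (f g : U -> V) :
  linear f -> linear g -> linear (fun u => f u - g u).
Proof. by move=> fL gL a u v; rewrite fL gL scalerBr opprD addrACA. Qed.

Lemma linear_id (k : fieldType) (U : lmodType k) : linear (fun u : U => u).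
Proof. by []. Qed.

Lemma linear_zero (k : fieldType) (U V : lmodType k) : linear (fun _ : U => 0 : V).
Proof. by move=> a u v; rewrite scaler0 addr0. Qed.

Lemma linear_ffun (k : fieldType) (U V : lmodType k) (I : finType) (f : I -> U -> V) :
  (forall i, linear (f i)) -> linear (fun u => [ffun i => f i u]).
Proof. by move=> fL a u v; apply/ffunP=> i; rewrite !ffunE fL. Qed.

(** * Choice principles and subspaces cut out by predicates *)

Lemma dependent_choice (T : nat -> Type) (G : forall i, T i -> Prop)
    (Q : forall i, T i -> T i.+1 -> Prop) :
  (exists x, G 0%N x) ->
  (forall i x, G i x -> exists2 y, G i.+1 y & Q i x y) ->
  exists f : forall i, T i, (forall i, G i (f i)) /\ forall i, Q i (f i) (f i.+1).
Proof.
move=> h0 hS.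
have next i (s : {x | G i x}) : {y : {y | G i.+1 y} | Q i (sval s) (sval y)}.
  apply: constructive_indefinite_description.
  by case: s => x Gx; have [y Gy Qy] := hS i x Gx; exists (exist _ y Gy).
pose s := nat_rect (fun i => {x | G i x}) (constructive_indefinite_description _ h0)
  (fun i si => sval (next i si)).
exists (fun i => sval (s i)); split=> i; first exact: svalP.
exact: (svalP (next i (s i))).
Qed.

Lemma family_choice (I T : Type) (Q : I -> T -> Prop) :
  (forall i, exists y, Q i y) -> exists f : I -> T, forall i, Q i (f i).
Proof.
move=> h.
exists (fun i => sval (constructive_indefinite_description _ (h i))) => i.
exact: svalP.
Qed.

(** A subspace of maximal dimension among those contained in [Q] is all of [Q], since a further
    vector of [Q] would enlarge it. Excluded middle makes the attained dimensions a boolean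
    predicate, as [ex_maxnP] requires. *)
Lemma vspace_of_prop (k : fieldType) (V : vectType k) (Q : V -> Prop) :
  Q 0 -> (forall a u v, Q u -> Q v -> Q (a *: u + v)) ->
  exists U : {vspace V}, forall u, u \in U <-> Q u.
Proof.
move=> Q0 QL.
have ub n : (exists2 U : {vspace V}, (forall u, u \in U -> Q u) & \dim U = n) ->
    (n <= \dim {:V})%N.
  by case=> U _ <-; exact: dimvS (subvf U).
pose S n := if excluded_middle_informative
  (exists2 U : {vspace V}, (forall u, u \in U -> Q u) & \dim U = n)
  then true else false.
have SP n : reflect (exists2 U : {vspace V}, (forall u, u \in U -> Q u) & \dim U = n) (S n).
  by rewrite /S; case: excluded_middle_informative => h; constructor.
have ex0 : exists n, S n.
  exists 0%N; apply/SP; exists 0%VS; last exact: dimv0.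
  by move=> u; rewrite memv0 => /eqP->.
have ubS n : S n -> (n <= \dim {:V})%N by move/SP; exact: ub.
case: (ex_maxnP ex0 ubS) => n /SP[U UQ dimU] nmax.
exists U => u; split=> [/UQ//|Qu]; apply/negPn/negP => uU.
have : S (\dim (U + <[u]>)%VS).
  apply/SP; exists (U + <[u]>)%VS => // v /memv_addP[v1 v1U [v2 /vlineP[a ->] ->]].
  by rewrite addrC; apply: QL => //; apply: UQ.
move/nmax; rewrite -dimU leqNgt => /negP; apply.
rewrite ltn_neqAle dimvS ?addvSl // andbT.
apply/eqP => e; case/negP: uU.
have /eqP-> : U == (U + <[u]>)%VS by rewrite eqEdim addvSl e leqnn.
by rewrite (subvP (addvSr U <[u]>)) ?memv_line.
Qed.

(** * Homological algebra *)

Section Kernel.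
Context (k : fieldType) (B : ralg k) (M N : rmod B) (f : {linear M -> N}).

Definition ker_pred : {pred M} := [pred x | f x == 0].

Lemma ker_pred_submod : submod_closed ker_pred.
Proof.
split=> [|a u v]; rewrite !inE ?linear0 // => /eqP fu /eqP fv.
by rewrite linearP fu fv scaler0 addr0.
Qed.

HB.instance Definition _ := GRing.isSubmodClosed.Build k M ker_pred ker_pred_submod.

Inductive ker_mod : predArgType := KerMod x & x \in ker_pred.

Definition ker_val u := let: KerMod x _ := u in x.

HB.instance Definition _ := [isSub for ker_val].
HB.instance Definition _ := [Choice of ker_mod by <:].
HB.instance Definition _ := [SubChoice_isSubLmodule of ker_mod by <:].

(** The default 0 of [insubd] gives operations before [f] is known to be a module map; once it is,
    they are the restricted ones ([val_kernel_act], [val_kernel_pr]). *)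
Definition kernel : rmod B :=
  @RMod k B ker_mod (fun b x => insubd (0 : ker_mod) (rm_act b (val x)))
    (fun n x => insubd (0 : ker_mod) (rm_pr n (val x))).

Lemma kernelP (x : kernel) : f (val x) = 0.
Proof. by apply/eqP; exact: (valP x). Qed.

Lemma val_linear : linear (val : kernel -> M).
Proof. by move=> a u v; exact: linearP. Qed.

Context (gr : bool) (modM : is_mod gr M) (modN : is_mod gr N) (fH : is_hom gr f).

Lemma val_kernel_act b (x : kernel) : val (rm_act b x) = rm_act b (val x).
Proof.
rewrite val_insubd; case: ifP => // /negbT/negP[]; rewrite inE.
case: fH => _ -> _; rewrite kernelP.
by case: modN => -[actL _] _ _ _; rewrite (lin0 (actL b)).
Qed.

Lemma val_kernel_pr n (x : kernel) : gr -> val (rm_pr n x) = rm_pr n (val x).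
Proof.
move=> hg; rewrite val_insubd; case: ifP => // /negbT/negP[]; rewrite inE.
case: fH => _ _ ->//; rewrite kernelP.
by case: modN => _ _ _ /(_ hg)[[prL _ _] _]; rewrite (lin0 (prL n)).
Qed.

Lemma kernel_is_mod : is_mod gr kernel.
Proof.
case: modM => -[actL1 actL2] actM act1 grM; split.
- split=> [b|x] a u v; apply: val_inj; rewrite val_linear !val_kernel_act.
    by rewrite val_linear actL1.
  by rewrite actL2.
- by move=> b c x; apply: val_inj; rewrite !val_kernel_act.
- by move=> x; apply: val_inj; rewrite val_kernel_act.
move=> hg; have [[prL prI prS] prA] := grM hg; split; first split.
- by move=> i a u v; apply: val_inj; rewrite val_linear !val_kernel_pr // val_linear prL.
- move=> i j x; apply: val_inj; rewrite !val_kernel_pr // prI.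
  by case: eqP => // _; rewrite ?val_kernel_pr ?(lin0 val_linear).
- move=> x; have [s us e] := prS (val x); exists s => //; apply: val_inj.
  by rewrite (lin_sum val_linear) {1}e; apply: eq_bigr => i _; rewrite val_kernel_pr // -e.
move=> i j b x hb hx; apply: val_inj.
rewrite val_kernel_pr // val_kernel_act prA //.
by rewrite -val_kernel_pr // hx.
Qed.

End Kernel.

Lemma eq_coboundary (k : fieldType) (B : ralg k) (P : chain B) (N : rmod B)
    (isC : forall M : rmod B, (M -> N) -> Prop) i (f g : P i -> N) :
  (forall x, f x = g x) -> coboundary isC f -> coboundary isC g.
Proof.
case: i f g => [|i] f g e /= => [h x|[u uC h]]; first by rewrite -e.
by exists u => // x; rewrite -e.
Qed.

(** * Comparison maps, homotopies and minimality *)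

Section Comparison.
Context (k : fieldType) (B : ralg k) (gr : bool).

Lemma is_hom_false (M N : rmod B) (f : M -> N) : is_hom gr f -> is_hom false f.
Proof. by case=> fL fA _; split. Qed.

Lemma is_mod_false (M : rmod B) : is_mod gr M -> is_mod false M.
Proof. by case=> h1 h2 h3 _; split. Qed.

Lemma is_hom_comp (M N L : rmod B) (f : N -> L) (g : M -> N) :
  is_hom gr f -> is_hom gr g -> is_hom gr (fun x => f (g x)).
Proof.
move=> [fL fA fP] [gL gA gP]; split; first exact: linear_comp.
  by move=> b x; rewrite gA fA.
by move=> hg n x; rewrite gP ?fP.
Qed.

Lemma is_hom_sub (M N : rmod B) (f g : M -> N) : is_mod gr N ->
  is_hom gr f -> is_hom gr g -> is_hom gr (fun x => f x - g x).
Proof.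
move=> [[actL _] _ _ prN] [fL fA fP] [gL gA gP]; split; first exact: linear_subf.
  by move=> b x; rewrite fA gA (linB (actL b)).
move=> hg n x; have [[prL _ _] _] := prN hg.
by rewrite fP // gP // (linB (prL n)).
Qed.

(** By exactness at [N], [d1] is a surjection onto the kernel of [d2], and [f] lands in that kernel
    too; projectivity is applied to the two corestrictions. *)
Lemma projective_lift (P M N L : rmod B) (d1 : M -> N) (d2 : N -> L) (f : P -> N) :
  projective gr P -> is_mod gr M -> is_mod gr N -> is_mod gr L ->
  is_hom gr d1 -> is_hom gr d2 -> is_hom gr f ->
  (forall y, d2 y = 0 <-> exists x, y = d1 x) -> (forall x, d2 (f x) = 0) ->
  exists2 f' : P -> M, is_hom gr f' & forall x, d1 (f' x) = f x.
Proof.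
move=> prP modM modN modL hom1 hom2 homf ex d2f.
have [d2L _ _] := hom2; pose F : {linear N -> L} := as_linear d2L.
have homF : is_hom gr F by [].
pose into (T : rmod B) (g : T -> N) (x : T) : kernel F := insubd (0 : ker_mod F) (g x).
have val_into (T : rmod B) (g : T -> N) x :
    (forall x, d2 (g x) = 0) -> val (into T g x) = g x.
  by move=> dg; rewrite val_insubd inE /= dg eqxx.
have homI (T : rmod B) (g : T -> N) : is_hom gr g -> (forall x, d2 (g x) = 0) ->
    is_hom gr (into T g).
  move=> [gL gA gP] dg; split.
  - by move=> a u v; apply: val_inj; rewrite val_linear !val_into // gL.
  - by move=> b x; apply: val_inj; rewrite (val_kernel_act modL homF) !val_into.
  - by move=> hg n x; apply: val_inj; rewrite (val_kernel_pr modL homF) // !val_into ?gP.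
have d2d1 x : d2 (d1 x) = 0 by apply/ex; exists x.
have [|f' homf' e] := prP M (kernel F) (into M d1) (into P f) modM
    (kernel_is_mod modN modL homF) (homI _ _ hom1 d2d1) _ (homI _ _ homf d2f).
  move=> y; have /ex[x e] : d2 (val y) = 0 by exact: (@kernelP _ _ _ _ F y).
  by exists x; apply: val_inj; rewrite val_into.
exists f' => // x.
by have /(congr1 val) := e x; rewrite !val_into.
Qed.

(** A resolution of [M] without projectivity of its terms: exactly what survives restriction from A
    # H to A for trivial reasons ([restrict_acyclic]). *)
Definition acyclic_over (M : rmod B) (Q : chain B) (e : Q 0%N -> M) : Prop :=
  [/\ is_mod gr M /\ forall i, is_mod gr (Q i),
      is_hom gr e /\ forall i, is_hom gr (ch_d (c := Q) (i := i)),
      surj e,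
      forall x, e x = 0 <-> exists y, x = ch_d y
    & forall i (x : Q i.+1), ch_d x = 0 <-> exists y, x = ch_d y].

Lemma acyclic_of_res (M : rmod B) (Q : chain B) :
  is_mod gr M -> is_proj_res gr M Q -> exists e, acyclic_over (M := M) (Q := Q) e.
Proof.
move=> modM [modQ homd [e [home sure exe]] exd]; exists e.
by split=> //; split=> // i; case: (modQ i).
Qed.

Lemma comparison (M : rmod B) (P Q : chain B) (eP : P 0%N -> M) (eQ : Q 0%N -> M) :
  (forall i, projective gr (P i)) -> acyclic_over eP -> acyclic_over eQ ->
  exists phi : forall i, P i -> Q i,
    [/\ forall i, is_hom gr (phi i),
        forall x, eQ (phi 0%N x) = eP x
      & forall i x, ch_d (phi i.+1 x) = phi i (ch_d x)].
Proof.
move=> prP [[modM modP] [homeP homP] _ exP0 exP] [[_ modQ] [homeQ homQ] surQ exQ0 exQ].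
have dP i x : ch_d (ch_d x : P i.+1) = 0 by apply/exP; exists x.
have eP0 x : eP (ch_d x) = 0 by apply/exP0; exists x.
(* The invariant says that f d lands in the cycles of [Q], as the next lift demands; in degree 0
   this follows from compatibility with the augmentations. *)
pose G i (f : P i -> Q i) := is_hom gr f /\
  match i return (P i -> Q i) -> Prop with
  | 0%N => fun f => forall x, eQ (f x) = eP x
  | j.+1 => fun f => forall x, ch_d (f (ch_d x)) = 0
  end f.
pose C i (f : P i -> Q i) (g : P i.+1 -> Q i.+1) := forall x, ch_d (g x) = f (ch_d x).
have [||phi [Gphi Cphi]] := @dependent_choice (fun i => P i -> Q i) G C.
- have [f homf e] := prP 0%N _ _ _ _ (modQ 0%N) modM homeQ surQ homeP.
  by exists f; split.
- move=> [|i] f [homf e].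
    have [] := projective_lift (prP 1%N) (modQ 1%N) (modQ 0%N) modM (homQ 0%N) homeQ
      (is_hom_comp homf (homP 0%N)) exQ0.
      by move=> x; rewrite e eP0.
    move=> g homg eg; exists g => //; split=> // x.
    by rewrite eg dP; case: homf => fL _ _; rewrite (lin0 fL).
  have [] := projective_lift (prP i.+2) (modQ i.+2) (modQ i.+1) (modQ i) (homQ i.+1)
    (homQ i) (is_hom_comp homf (homP i.+1)) (exQ i).
    exact: e.
  move=> g homg eg; exists g => //; split=> // x.
  by rewrite eg dP; case: homf => fL _ _; rewrite (lin0 fL).
exists phi; split=> [i|x|//]; first by case: (Gphi i).
by case: (Gphi 0%N) => _; apply.
Qed.

(* Only the value of the homotopy at one spot is needed, so it is not         *)
(* assembled into a family.                                                   *)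
Lemma homotopy (M : rmod B) (P Q : chain B) (eP : P 0%N -> M) (eQ : Q 0%N -> M)
    (phi : forall i, P i -> Q i) :
  (forall i, projective gr (P i)) -> acyclic_over eP -> acyclic_over eQ ->
  (forall i, is_hom gr (phi i)) -> (forall x, eQ (phi 0%N x) = 0) ->
  (forall i x, ch_d (phi i.+1 x) = phi i (ch_d x)) ->
  forall i, exists2 h : P i -> Q i.+1, is_hom gr h &
    match i return (P i -> Q i) -> (P i -> Q i.+1) -> Prop with
    | 0%N => fun f h => forall x, f x = ch_d (h x)
    | j.+1 => fun f h => exists2 h' : P j -> Q j.+1, is_hom gr h' &
        forall x, f x = ch_d (h x) + h' (ch_d x)
    end (phi i) h.
Proof.
move=> prP [[modM modP] [homeP homP] _ exP0 exP] [[_ modQ] [homeQ homQ] surQ exQ0 exQ].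
move=> homphi ephi dphi.
have dP i x : ch_d (ch_d x : P i.+1) = 0 by apply/exP; exists x.
elim=> [|i [h homh e]].
  have [h homh e] := projective_lift (prP 0%N) (modQ 1%N) (modQ 0%N) modM (homQ 0%N)
    homeQ (homphi 0%N) exQ0 ephi.
  by exists h.
have dL : linear (ch_d (c := Q) (i := i)) by case: (homQ i).
(* As d phi_(i+1) = phi_i d = d h d + h' d d and d d = 0, the map phi_(i+1) - h d takes values in
   the cycles. *)
have key x : ch_d (phi i.+1 x - h (ch_d x)) = 0.
  rewrite (linB dL) dphi.
  case: i h homh e dL x => [|i] h homh e dL x; first by rewrite e subrr.
  have [h' [h'L _ _] e'] := e.
  by rewrite e' dP (lin0 h'L) addr0 subrr.
have [g homg eg] := projective_lift (prP i.+1) (modQ i.+2) (modQ i.+1) (modQ i)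
  (homQ i.+1) (homQ i)
  (is_hom_sub (modQ i.+1) (homphi i.+1) (is_hom_comp homh (homP i))) (exQ i) key.
by exists g => //; exists h => // x; rewrite eg subrK.
Qed.

(* If psi : K -> P lifts the identity of M, then phi psi - id is null         *)
(* homotopic, and f does not see a homotopy because K is minimal.             *)
Lemma minimal_pullback (M T : rmod B) (K P : chain B)
    (eK : K 0%N -> M) (eP : P 0%N -> M)
    (phi : forall i, P i -> K i) (i : nat) (f : K i -> T) :
  (forall i, projective gr (K i)) -> acyclic_over eK -> acyclic_over eP ->
  (forall i, is_hom gr (phi i)) -> (forall x, eK (phi 0%N x) = eP x) ->
  (forall i x, ch_d (phi i.+1 x) = phi i (ch_d x)) ->
  (forall j (g : K j -> T), is_hom gr g -> forall x, g (ch_d x) = 0) ->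
  is_hom gr f ->
  coboundary (P := P) (fun L (g : L -> T) => is_hom gr g) (fun x => f (phi i x)) ->
  forall x, f x = 0.
Proof.
move=> prK acK acP homphi ephi dphi minK homf cob x.
have [psi [hompsi epsi dpsi]] := comparison prK acK acP.
have [[modM modK] [homeK homK] _ _ _] := acK.
pose c j (y : K j) := phi j (psi j y) - y.
have homc j : is_hom gr (c j).
  by apply: is_hom_sub; [exact: modK | exact: is_hom_comp | split].
have eKL : linear eK by case: homeK.
have ec y : eK (c 0%N y) = 0 by rewrite (linB eKL) ephi epsi subrr.
have dc j y : ch_d (c j.+1 y) = c j (ch_d y).
  have dL : linear (ch_d (c := K) (i := j)) by case: (homK j).
  by rewrite /c (linB dL) dphi dpsi.
have [h homh e] := homotopy prK acK acK homc ec dc i.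
have fL : linear f by case: homf.
(* Both terms d h and h' d of the homotopy die: [f] vanishes on boundaries by minimality, and so
   does f h'. *)
have fc : f (c i x) = 0.
  case: i f homf cob x h homh e fL => [|i] f homf cob x h homh e fL.
    by rewrite e (minK _ _ homf).
  have [h' homh' e'] := e.
  rewrite e' (linD fL) (minK _ _ homf) add0r.
  by rewrite (minK _ (fun y => f (h' y)) (is_hom_comp homf homh')).
move: fc; rewrite /c (linB fL) => /eqP; rewrite subr_eq0 => /eqP <-.
(* Now f = (f phi) psi. If f phi = g d, then f = g d psi = (g psi) d, which minimality kills
   again. *)
case: i f homf cob x {h homh e fL} => [|i] f homf cob x; first exact: cob.
have [g homg eg] := cob.
by rewrite eg dpsi (minK _ (fun y => g (psi i y)) (is_hom_comp homg (hompsi i))).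
Qed.

End Comparison.

(** * Hopf algebras *)

Section TensLift.
Context (k : fieldType) (X : lmodType k) (U : vectType k).

Definition bilinear2 (Y : lmodType k) (beta : X -> U -> Y) : Prop :=
  (forall u, linear (beta^~ u)) /\ (forall x, linear (beta x)).

Lemma vbasis_expand (u : U) :
  u = \sum_(j < \dim {:U}) coord (vbasis {:U}) j u *: (vbasis {:U})`_j.
Proof. by rewrite -coord_vbasis ?memvf. Qed.

(** Here the chosen basis of [U] drops out: linearity in the second argument reassembles [u] from
    its coordinates. *)
Lemma tens_lift_pure (Y : lmodType k) (beta : X -> U -> Y) x u :
  bilinear2 beta -> tens_lift beta (pure x u) = beta x u.
Proof.
move=> [bL bR]; rewrite [in RHS](vbasis_expand u) (lin_sum (bR x)).
by apply: eq_bigr => j _; rewrite ffunE (linZ (bL _)) (linZ (bR x)).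
Qed.

Lemma tens_lift_linear (Y : lmodType k) (beta : X -> U -> Y) :
  (forall u, linear (beta^~ u)) -> linear (tens_lift beta).
Proof.
move=> bL a s t; rewrite /tens_lift scaler_sumr -big_split /=.
by apply: eq_bigr => j _; rewrite !ffunE bL.
Qed.

Lemma tens_lift_comp (Y Z : lmodType k) (f : Y -> Z) (beta : X -> U -> Y) t :
  linear f -> f (tens_lift beta t) = tens_lift (fun x u => f (beta x u)) t.
Proof. by move=> fL; rewrite /tens_lift (lin_sum fL). Qed.

Lemma eq_tens_lift (Y : lmodType k) (beta gamma : X -> U -> Y) t :
  (forall x u, beta x u = gamma x u) -> tens_lift beta t = tens_lift gamma t.
Proof. by move=> e; apply: eq_bigr => j _; rewrite e. Qed.

Lemma tens_lift_sum (Y : lmodType k) I (r : seq I) (P : pred I)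
    (beta : I -> X -> U -> Y) t :
  tens_lift (fun x u => \sum_(i <- r | P i) beta i x u) t =
  \sum_(i <- r | P i) tens_lift (beta i) t.
Proof. exact: exchange_big. Qed.

Lemma pure_bilinear : bilinear2 (@pure k X U).
Proof.
split=> [u|x] a v w; apply/ffunP=> j; rewrite !ffunE.
  by rewrite scalerDr !scalerA mulrC.
by rewrite linearP scalerDl scalerA.
Qed.

End TensLift.

Lemma linear_mull (k : fieldType) (R : algType k) (b : R) : linear (fun a : R => a * b).
Proof. by move=> a u v; rewrite mulrDl scalerAl. Qed.

Lemma linear_mulr (k : fieldType) (R : algType k) (a : R) : linear (fun b : R => a * b).
Proof. by move=> c u v; rewrite mulrDr scalerAr. Qed.

Lemma linear_scale_form (k : fieldType) (U Y : lmodType k) (phi : U -> k) (b : Y) :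
  linear (phi : U -> k^o) -> linear (fun a => phi a *: b).
Proof. by move=> phiL c u v; rewrite phiL scalerDl scalerA. Qed.

Section Hopf.
Context (k : fieldType) (H : hopfAlg k).

Lemma coprod_linear : linear (@coprod k H). Proof. by case: H. Qed.

Lemma counit_scalar : scalar (@counit k H). Proof. by case: H. Qed.

Lemma counit_linear : linear (@counit k H : H -> k^o).
Proof. exact: counit_scalar. Qed.

Lemma antip_linear : linear (@antip k H). Proof. by case: H. Qed.

Definition sw (Y : lmodType k) (beta : H -> H -> Y) (h : H) : Y :=
  tens_lift beta (coprod h).

Lemma sw_linear (Y : lmodType k) (beta : H -> H -> Y) :
  (forall u, linear (beta^~ u)) -> linear (sw beta).
Proof. by move=> bL; apply: linear_comp coprod_linear; exact: tens_lift_linear. Qed.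

Lemma eq_sw (Y : lmodType k) (beta gamma : H -> H -> Y) h :
  (forall x u, beta x u = gamma x u) -> sw beta h = sw gamma h.
Proof. exact: eq_tens_lift. Qed.

(* Equality in k, where eq_sw would not find the module k^o. *)
Lemma eq_sw_form (beta gamma : H -> H -> k^o) h :
  (forall x u, beta x u = gamma x u) -> sw beta h = sw gamma h :> k.
Proof. exact: eq_sw. Qed.

Lemma sw_comp (Y Z : lmodType k) (f : Y -> Z) (beta : H -> H -> Y) h :
  linear f -> f (sw beta h) = sw (fun x u => f (beta x u)) h.
Proof. exact: tens_lift_comp. Qed.

Lemma sw_sum (Y : lmodType k) I (r : seq I) (P : pred I) (beta : I -> H -> H -> Y) h :
  sw (fun x u => \sum_(i <- r | P i) beta i x u) h = \sum_(i <- r | P i) sw (beta i) h.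
Proof. exact: tens_lift_sum. Qed.

Lemma linear_sw (Z Y : lmodType k) (beta : Z -> H -> H -> Y) h :
  (forall x u, linear (fun z => beta z x u)) -> linear (fun z => sw (beta z) h).
Proof. by move=> bL; apply: linear_sumf. Qed.

(** The axiom is an identity in (H (x) H) (x) H; the linear map [T] induced by a trilinear [gamma]
    turns it into an identity of Sweedler sums in any module. *)
Lemma sw_coassoc (Y : lmodType k) (gamma : H -> H -> H -> Y) h :
  (forall b c, linear (fun a => gamma a b c)) ->
  (forall a c, linear (fun b => gamma a b c)) ->
  (forall a b, linear (fun c => gamma a b c)) ->
  sw (fun h1 h2 => sw (fun a b => gamma a b h2) h1) h =
  sw (fun h1 h2 => sw (fun a b => gamma h1 a b) h2) h.
Proof.
move=> g1 g2 g3.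
pose T := tens_lift (fun (p : tens H H) u => tens_lift (fun a b => gamma a b u) p).
have bT : bilinear2 (fun (p : tens H H) u => tens_lift (fun a b => gamma a b u) p).
  split=> [u|p]; first by apply: tens_lift_linear => b; exact: g1.
  by apply: linear_sumf => j; exact: g3.
have TL : linear T by apply: tens_lift_linear; case: bT.
have coa : tens_lift (fun h1 h2 => tens_lift (fun h11 h12 =>
          pure (pure h11 h12) h2) (coprod h1)) (coprod h) =
        tens_lift (fun h1 h2 => tens_lift (fun h21 h22 =>
          pure (pure h1 h21) h22) (coprod h2)) (coprod h) by case: {gamma g1 g2 g3 T bT TL} H h.
have Tp a b c : T (pure (pure a b) c) = gamma a b c.
  by rewrite /T tens_lift_pure // tens_lift_pure.
(* Both sides of the axiom have this shape: [t] selects the leg that is split again, and [beta] puts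
   the three factors in order. *)
have Tl t (beta : H -> H -> H -> H -> H * H * H) :
    T (tens_lift (fun x u => tens_lift (fun x' u' => let: (a, b, c) := beta x u x' u' in
        pure (pure a b) c) (coprod (t x u))) (coprod h)) =
    sw (fun x u => sw (fun x' u' => let: (a, b, c) := beta x u x' u' in gamma a b c) (t x u)) h.
  rewrite (tens_lift_comp _ _ TL); apply: eq_tens_lift => x u.
  rewrite (tens_lift_comp _ _ TL); apply: eq_tens_lift => x' u'.
  by case: beta => -[a b] c; exact: Tp.
have := congr1 T coa.
rewrite (Tl (fun x _ => x) (fun _ u x' u' => (x', u', u))).
by rewrite (Tl (fun _ u => u) (fun x _ x' u' => (x, x', u'))).
Qed.

Lemma sw_counitl (Y : lmodType k) (f : H -> Y) h : linear f ->
  sw (fun h1 h2 => counit h1 *: f h2) h = f h.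
Proof.
move=> fL.
have e : tens_lift (fun h1 h2 => counit h1 *: h2) (coprod h) = h.
  by case: {f fL} H h.
rewrite -[in RHS]e (tens_lift_comp _ _ fL).
by apply: eq_tens_lift => x u; rewrite (linZ fL).
Qed.

Lemma sw_counitr (Y : lmodType k) (f : H -> Y) h : linear f ->
  sw (fun h1 h2 => counit h2 *: f h1) h = f h.
Proof.
move=> fL.
have e : tens_lift (fun h1 h2 => counit h2 *: h1) (coprod h) = h.
  by case: {f fL} H h.
rewrite -[in RHS]e (tens_lift_comp _ _ fL).
by apply: eq_tens_lift => x u; rewrite (linZ fL).
Qed.

Lemma sw1 (Y : lmodType k) (beta : H -> H -> Y) : bilinear2 beta ->
  sw beta 1 = beta 1 1.
Proof.
move=> bb; have e : coprod (1 : H) = pure 1 1 by case: {beta bb} H.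
by rewrite /sw e tens_lift_pure.
Qed.

Lemma swM (Y : lmodType k) (beta : H -> H -> Y) g h : bilinear2 beta ->
  sw beta (g * h) = sw (fun g1 g2 => sw (fun h1 h2 => beta (g1 * h1) (g2 * h2)) h) g.
Proof.
move=> bb.
have e : coprod (g * h) = tens_lift (fun g1 g2 => tens_lift (fun h1 h2 =>
          pure (g1 * h1) (g2 * h2)) (coprod h)) (coprod g).
  by case: {beta bb} H g h.
have bL : linear (tens_lift beta) by apply: tens_lift_linear; case: bb.
rewrite /sw e (tens_lift_comp _ _ bL); apply: eq_tens_lift => x u.
rewrite (tens_lift_comp _ _ bL); apply: eq_tens_lift => x' u'.
by rewrite tens_lift_pure.
Qed.

Lemma counit1 : counit (1 : H) = 1. Proof. by case: H. Qed.

Lemma counitM (g h : H) : counit (g * h) = counit g * counit h.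
Proof. by case: H g h. Qed.

Lemma sw_antipl (h : H) : sw (fun h1 h2 => antip h1 * h2) h = counit h *: 1.
Proof. by rewrite /sw; case: H h. Qed.

Lemma sw_antipr (h : H) : sw (fun h1 h2 => h1 * antip h2) h = counit h *: 1.
Proof. by rewrite /sw; case: H h. Qed.

Lemma antip1 : antip (1 : H) = 1.
Proof.
have := sw_antipl 1; rewrite counit1 scale1r sw1 ?mulr1 //.
split=> [u|x]; last exact: linear_mulr.
by apply: linear_comp (linear_mull u) antip_linear.
Qed.

Record is_character (chi : H -> k) : Prop := IsCharacter {
  character_scalar : scalar chi;
  character1 : chi 1 = 1;
  characterM : forall g h, chi (g * h) = chi g * chi h
}.

(** The winding endomorphism, that is convolution of the identity with [chi] on the left. The counit
    recovers [chi] from it ([counit_winding]), so identities between forms can be checked on winding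
    maps. *)
Definition winding (chi : H -> k) (h : H) : H := sw (fun a b => chi a *: b) h.

Section Winding.
Context (chi : H -> k) (chiC : is_character chi).

Let chiS := character_scalar chiC.
Let chiL : linear (chi : H -> k^o) := chiS.
Let psi h := chi (antip h).

Let psiL : linear (psi : H -> k^o).
Proof. by move=> a u v; rewrite /psi antip_linear chiL. Qed.

Lemma winding_linear (phi : H -> k) : linear (phi : H -> k^o) -> linear (winding phi).
Proof. by move=> phiL; apply: sw_linear => u; exact: linear_scale_form. Qed.

Lemma windingM g h : winding chi (g * h) = winding chi g * winding chi h.
Proof.
rewrite /winding swM; last first.
  by split=> u; [exact: linear_scale_form | exact: linear_scalef].
rewrite (sw_comp _ _ (linear_mull _)); apply: eq_sw => a b.
rewrite (sw_comp _ _ (linear_mulr _)); apply: eq_sw => c d.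
by rewrite (characterM chiC) -scalerAl -scalerAr scalerA.
Qed.

Lemma counit_winding (phi : H -> k) h : linear (phi : H -> k^o) ->
  counit (winding phi h) = phi h.
Proof.
move=> phiL; rewrite /winding (sw_comp _ _ counit_linear).
rewrite -[RHS](sw_counitr (Y := k^o) h phiL).
rewrite /sw; apply: eq_bigr => j _.
by rewrite (linZ counit_linear) /= [LHS]mulrC.
Qed.

(** The composite is the winding map of the convolution product of [psi] and [chi], and
    chi(S(a_(1))) chi(a_(2)) = chi(S(a_(1)) a_(2)) = counit(a). *)
Lemma winding_antipK h : winding chi (winding psi h) = h.
Proof.
rewrite {2}/winding (sw_comp _ _ (winding_linear chiL)).
transitivity (sw (fun a b => sw (fun b1 b2 => (psi a * chi b1) *: b2) b) h).
  apply: eq_sw => a b; rewrite (linZ (winding_linear chiL)).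
  rewrite /winding (sw_comp _ _ (linear_scale _)).
  by apply: eq_sw => b1 b2; rewrite scalerA.
rewrite -(sw_coassoc (gamma := fun a b c => (psi a * chi b) *: c)).
- rewrite -[RHS](sw_counitl _ (@linear_id k H)); apply: eq_sw => a b.
  transitivity (chi (sw (fun a1 a2 => antip a1 * a2) a) *: b).
    rewrite (sw_comp _ _ chiL) (sw_comp _ _ (linear_scalel b)).
    by apply: eq_sw => c d; rewrite (characterM chiC).
  by rewrite sw_antipl (linZ chiL) (character1 chiC) [_ *: 1]mulr1.
- move=> b c z u v; rewrite psiL mulrDl scalerDl scalerA; congr (_ *: _ + _).
  by rewrite -mulrA.
- move=> a c z u v; rewrite chiS mulrDr scalerDl scalerA; congr (_ *: _ + _).
  by rewrite mulrCA.
- by move=> a b; exact: linear_scalef.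
Qed.

Lemma antip_windingK h : winding psi (winding chi h) = h.
Proof.
rewrite {2}/winding (sw_comp _ _ (winding_linear psiL)).
transitivity (sw (fun a b => sw (fun b1 b2 => (chi a * psi b1) *: b2) b) h).
  apply: eq_sw => a b; rewrite (linZ (winding_linear psiL)).
  rewrite /winding (sw_comp _ _ (linear_scale _)).
  by apply: eq_sw => b1 b2; rewrite scalerA.
rewrite -(sw_coassoc (gamma := fun a b c => (chi a * psi b) *: c)).
- rewrite -[RHS](sw_counitl _ (@linear_id k H)); apply: eq_sw => a b.
  transitivity (chi (sw (fun a1 a2 => a1 * antip a2) a) *: b).
    rewrite (sw_comp _ _ chiL) (sw_comp _ _ (linear_scalel b)).
    by apply: eq_sw => c d; rewrite (characterM chiC).
  by rewrite sw_antipr (linZ chiL) (character1 chiC) [_ *: 1]mulr1.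
- move=> b c z u v; rewrite chiS mulrDl scalerDl scalerA; congr (_ *: _ + _).
  by rewrite -mulrA.
- move=> a c z u v; rewrite psiL mulrDr scalerDl scalerA; congr (_ *: _ + _).
  by rewrite mulrCA.
- by move=> a b; exact: linear_scalef.
Qed.

(* The winding map of chi o S inverts that of chi, so chi o S is              *)
(* multiplicative although the antipode has not been shown to reverse         *)
(* products.                                                                  *)
Lemma antip_character : is_character psi.
Proof.
split; first exact: psiL.
  by rewrite /psi antip1 (character1 chiC).
move=> g h; have wM : winding psi (g * h) = winding psi g * winding psi h.
  by rewrite -{1}(winding_antipK g) -{1}(winding_antipK h) -windingM antip_windingK.
by rewrite -(counit_winding (g * h) psiL) wM counitM !counit_winding.
Qed.

End Winding.

(** Inverses are unique: the winding maps of [chi] and of [chi] o S o S are both inverse to that of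
    [chi] o S. *)
Lemma character_antip2 (chi : H -> k) h :
  is_character chi -> chi (antip (antip h)) = chi h.
Proof.
move=> chiC; have psiC := antip_character chiC.
have chiL := character_scalar chiC.
have phiL : linear ((fun h => chi (antip (antip h))) : H -> k^o).
  exact: character_scalar (antip_character psiC).
rewrite -(counit_winding h phiL) -(counit_winding h chiL).
by rewrite -[in RHS](antip_windingK psiC (winding chi h)) antip_windingK.
Qed.

End Hopf.

(** * Words *)

Section Span.
Context (k : fieldType) (M : lmodType k) (S : M -> Prop).

Lemma in_span0 : in_span S 0.
Proof.
by exists 0%N, (fun=> 0), (fun=> 0); split=> [[]|] //; rewrite big_ord0.
Qed.

Lemma in_span_gen u : S u -> in_span S u.
Proof.
by move=> Su; exists 1%N, (fun=> 1), (fun=> u); split=> //; rewrite big_ord1 scale1r.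
Qed.

Lemma in_span_lin a u v : in_span S u -> in_span S v -> in_span S (a *: u + v).
Proof.
move=> [n [c [y [Sy ->]]]] [n' [c' [y' [Sy' ->]]]].
pose pick T (f : 'I_n -> T) (f' : 'I_n' -> T) (j : 'I_(n + n')) :=
  match split j with inl i => f i | inr i => f' i end.
exists (n + n')%N, (pick _ (fun i => a * c i) c'), (pick _ y y'); split.
  by move=> j; rewrite /pick; case: split.
rewrite big_split_ord /= scaler_sumr; congr (_ + _).
  by apply: eq_bigr => i _; rewrite /pick (unsplitK (inl i)) scalerA.
by apply: eq_bigr => i _; rewrite /pick (unsplitK (inr i)).
Qed.

Lemma in_span_ind (Q : M -> Prop) :
  Q 0 -> (forall a u v, Q u -> Q v -> Q (a *: u + v)) -> (forall u, S u -> Q u) ->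
  forall u, in_span S u -> Q u.
Proof.
move=> Q0 QL QS u [n [c [y [Sy ->]]]].
apply: (big_ind Q) => // [v v' Qv Qv'|j _]; first by rewrite -[v]scale1r; exact: QL.
by rewrite -[_ *: _]addr0; apply: QL => //; exact: QS.
Qed.

Lemma in_span_sum I (r : seq I) (P : pred I) (f : I -> M) :
  (forall i, P i -> in_span S (f i)) -> in_span S (\sum_(i <- r | P i) f i).
Proof.
move=> h; apply: big_ind => //; first exact: in_span0.
by move=> u v Su Sv; rewrite -[u]scale1r; exact: in_span_lin.
Qed.

End Span.

Lemma eq_in_span (k : fieldType) (M : lmodType k) (S T : M -> Prop) u :
  (forall v, S v -> T v) -> in_span S u -> in_span T u.
Proof. by move=> h [n [c [y [Sy ->]]]]; exists n, c, y; split=> // j; exact: h. Qed.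

Section Words.
Context (N : nat).

Lemma tcoef_tuple (X : nmodType) n (F : tpow X N n) (t : n.-tuple 'I_N) : tcoef F t = F t.
Proof. by rewrite /tcoef valK. Qed.

Lemma tcoef_ffun (X : nmodType) n (E : seq 'I_N -> X) s : size s = n ->
  tcoef [ffun t : n.-tuple 'I_N => E t] s = E s.
Proof. by move/eqP=> hs; rewrite -[s]/(val (Tuple hs)) tcoef_tuple ffunE. Qed.

Lemma tpow_ext (X : nmodType) n (F G : tpow X N n) :
  (forall s, size s = n -> tcoef F s = tcoef G s) -> F = G.
Proof.
by move=> h; apply/ffunP=> t; rewrite -!tcoef_tuple h ?size_tuple.
Qed.

Lemma tcoef_linear (k : fieldType) (X : lmodType k) n s :
  linear (fun F : tpow X N n => tcoef F s).
Proof.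
move=> a F G; rewrite /tcoef; case: insub => [t|]; first by rewrite !ffunE.
by rewrite scaler0 addr0.
Qed.

Lemma sum_tuple_cat (X : nmodType) p q n (E : seq 'I_N -> X) : (p + q)%N = n ->
  \sum_(t : n.-tuple 'I_N) E t =
  \sum_(a : p.-tuple 'I_N) \sum_(b : q.-tuple 'I_N) E (a ++ b).
Proof.
move=> <-; rewrite pair_big /=.
have htake (t : (p + q).-tuple 'I_N) : size (take p t) == p.
  by rewrite size_takel // size_tuple leq_addr.
have hdrop (t : (p + q).-tuple 'I_N) : size (drop p t) == q.
  by rewrite size_drop size_tuple addKn.
rewrite (reindex (fun u : p.-tuple 'I_N * q.-tuple 'I_N => [tuple of u.1 ++ u.2])) //=.
exists (fun t => (Tuple (htake t), Tuple (hdrop t))) => [[a b] _|t _].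
  congr (_, _); apply: val_inj => /=.
    by rewrite take_size_cat ?size_tuple.
  by rewrite drop_size_cat ?size_tuple.
by apply: val_inj; rewrite /= cat_take_drop.
Qed.

Lemma tcoef_tmul (k : fieldType) p q n (F : tpow k^o N p) (G : tpow k^o N q) s :
  size s = n -> tcoef (tmul n F G) s = tcoef F (take p s) * tcoef G (drop p s).
Proof. exact: (tcoef_ffun (fun s => tcoef F (take p s) * tcoef G (drop p s))). Qed.

End Words.

(** * Slices of tensors and the spaces W_n *)

Section Slices.
Context (k : fieldType) (N m : nat) (R : tpow k^o N m -> Prop).

Definition slice n (F : tpow k^o N n) (a b : seq 'I_N) : tpow k^o N m :=
  [ffun c : m.-tuple 'I_N => tcoef F (a ++ c ++ b)].

Lemma slice_linear n a b : linear (fun F : tpow k^o N n => slice F a b).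
Proof. by apply: linear_ffun => c; exact: tcoef_linear. Qed.

(** Words form bases of the outer factors V^{(x) i} and V^{(x) j}, so membership can be tested with
    the outer letters fixed. Conversely, [F] is the sum over all outer words of its slices put back
    between them. *)
Lemma sandwich_slice i j n (F : tpow k^o N n) : (i + m + j)%N = n ->
  in_span (sandwich R i j (n := n)) F <->
  (forall a b, size a = i -> size b = j -> in_span R (slice F a b)).
Proof.
move=> nE; split=> [FR a b ha hb|h].
  move: F FR; apply: in_span_ind => [|c F G FR GR|F [u [r [v [Rr ->]]]]].
  - by rewrite (lin0 (@slice_linear n a b)); exact: in_span0.
  - by rewrite slice_linear; exact: in_span_lin.
  have -> : slice (tmul n u (tmul (m + j) r v)) a b = (tcoef u a * tcoef v b) *: r + 0.
    apply/ffunP=> c; rewrite addr0 !ffunE tcoef_tmul; last first.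
      by rewrite !size_cat size_tuple ha hb addnA.
    rewrite take_size_cat // drop_size_cat // tcoef_tmul; last first.
      by rewrite !size_cat size_tuple hb.
    rewrite take_size_cat ?size_tuple // drop_size_cat ?size_tuple // tcoef_tuple.
    by rewrite mulrA mulrAC.
  by apply: in_span_lin (in_span_gen Rr) (in_span0 _).
(* The word [s] itself, as a basis tensor. *)
pose dl p (s : p.-tuple 'I_N) : tpow k^o N p := [ffun t : p.-tuple 'I_N => (val t == s)%:R].
have tdl p (s : p.-tuple 'I_N) t : size t = p -> tcoef (dl p s) t = (t == s)%:R.
  exact: (tcoef_ffun (fun t => (t == s :> seq _)%:R)).
have -> : F = \sum_(a : i.-tuple 'I_N) \sum_(b : j.-tuple 'I_N)
    tmul n (dl i a) (tmul (m + j) (slice F a b) (dl j b)).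
  apply: tpow_ext => s hs.
  rewrite (lin_sum (@tcoef_linear _ _ _ _ s)).
  have ha : size (take i s) == i by rewrite size_takel // hs -nE -addnA leq_addr.
  have hb : size (drop m (drop i s)) == j.
    by rewrite drop_drop size_drop hs -nE [(m + i)%N]addnC addKn.
  have hc : size (take m (drop i s)) == m.
    by rewrite size_takel // size_drop hs -nE -addnA addKn leq_addr.
  under eq_bigr => a _ do rewrite (lin_sum (@tcoef_linear _ _ _ _ s)).
  have hd : size (drop i s) = (m + j)%N by rewrite size_drop hs -nE -addnA addKn.
  have e (a : i.-tuple 'I_N) (b : j.-tuple 'I_N) :
      tcoef (tmul n (dl i a) (tmul (m + j) (slice F a b) (dl j b))) s =
      (take i s == a)%:R *
        (tcoef (slice F a b) (take m (drop i s)) * (drop m (drop i s) == b)%:R).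
    by rewrite tcoef_tmul // tcoef_tmul // !tdl //; exact/eqP.
  rewrite (bigD1 (Tuple ha)) //= [X in _ + X]big1 ?addr0 => [|a na]; last first.
    apply: big1 => b _; rewrite e (_ : (take i s == a) = false) ?mul0r //.
    by rewrite eq_sym; exact: negbTE na.
  rewrite (bigD1 (Tuple hb)) //= [X in _ + X]big1 ?addr0 => [|b nb]; last first.
    rewrite e (_ : (drop m (drop i s) == b) = false) ?mulr0 //.
    by rewrite eq_sym; exact: negbTE nb.
  rewrite [RHS](e (Tuple ha) (Tuple hb)) !eqxx mul1r mulr1.
  rewrite -[take m _]/(val (Tuple hc)) tcoef_tuple ffunE /=.
  by rewrite !cat_take_drop.
apply: in_span_sum => a _; apply: in_span_sum => b _.
have := h a b (size_tuple _) (size_tuple _); move: (slice F a b).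
have tL : linear (fun G : tpow k^o N m => tmul n (dl i a) (tmul (m + j) G (dl j b))).
  apply: linear_ffun => t c G G'.
  have ht : size (drop i t) = (m + j)%N by rewrite size_drop size_tuple -nE -addnA addKn.
  rewrite !tcoef_tmul // tcoef_linear mulrDl mulrDr.
  by congr (_ + _); rewrite -scalerAl -scalerAr.
apply: in_span_ind => [|c G G' hG hG'|G RG].
- by rewrite (lin0 tL); exact: in_span0.
- by rewrite tL; exact: in_span_lin.
- by apply: in_span_gen; exists (dl i a), G, (dl j b).
Qed.

(** In degree m there is no room for outer letters: i + m + j = m forces i = j = 0. *)
Lemma ideal_deg_same (G : tpow k^o N m) : ideal_deg R G <-> in_span R G.
Proof.
have sl : slice G [::] [::] = G.
  by apply/ffunP=> t; rewrite ffunE /= cats0 tcoef_tuple.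
have sw0 : in_span (sandwich R 0 0 (n := m)) G <-> in_span R G.
  have mE : (0 + m + 0)%N = m by rewrite addn0.
  rewrite (sandwich_slice _ mE); split=> [/(_ [::] [::] erefl erefl)|h a b]; first by rewrite sl.
  by move=> /size0nil-> /size0nil->; rewrite sl.
rewrite -sw0; split; apply: eq_in_span => F; last by exists 0%N, 0%N; rewrite addn0.
move=> [i [j [e]]].
have : (i + j)%N = 0%N by apply/eqP; rewrite -(eqn_add2r m) addnAC e add0n.
by move/eqP; rewrite addn_eq0 => /andP[/eqP-> /eqP->].
Qed.

Context (A : cgAlg k) (x : 'I_N -> A) (hR : presents R x).

(* The right-hand side mentions A but not R, which makes W_n visibly stable   *)
(* under every Hopf action on A.                                              *)
Lemma koszul_spaceP n (F : tpow k^o N n) :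
  koszul_space R F <->
  forall i j a b, (i + m + j)%N = n -> size a = i -> size b = j ->
    teval x (slice F a b) = 0.
Proof.
case: hR => _ hR2; split=> [hF i j a b e ha hb|h i j e].
  apply/hR2/ideal_deg_same.
  by move: a b ha hb; apply/(sandwich_slice F e); exact: hF.
by apply/(sandwich_slice F e) => a b ha hb; apply/ideal_deg_same/hR2/(h i j).
Qed.

Lemma koszul_space_submod n :
  exists W : {vspace tpow k^o N n}, forall F, F \in W <-> koszul_space R F.
Proof.
apply: vspace_of_prop => [i j _|c F G hF hG i j e]; first exact: in_span0.
by apply: in_span_lin; [exact: hF | exact: hG].
Qed.

End Slices.

Lemma sum_tuple_cons (N n : nat) (X : nmodType) (E : seq 'I_N -> X) :
  \sum_(t : n.+1.-tuple 'I_N) E t = \sum_a \sum_(t : n.-tuple 'I_N) E (a :: t).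
Proof.
rewrite pair_big /= (reindex (fun u : 'I_N * n.-tuple 'I_N => [tuple of u.1 :: u.2])) //=.
exists (fun t => (thead t, [tuple of behead t])) => [[a t] _|t _].
  by congr (_, _); apply: val_inj.
by rewrite [RHS]tuple_eta; apply: val_inj.
Qed.

Lemma sum_tuple0 (N : nat) (X : nmodType) (E : seq 'I_N -> X) :
  \sum_(t : 0.-tuple 'I_N) E t = E [::].
Proof.
rewrite (eq_bigr (fun=> E [::])) => [|t _]; last by rewrite tuple0.
by rewrite sumr_const card_tuple expn0 mulr1n.
Qed.

(** * Hopf actions on words *)

Section Action.
Context (k : fieldType) (A : cgAlg k) (N : nat) (x : 'I_N -> A) (hx : deg1_basis x).
Context (H : hopfAlg k) (act : H -> A -> A) (hact : module_algebra act).
Context (rho_V : H -> 'M[k]_N)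
  (hV : forall h j, act h (x j) = \sum_i rho_V h i j *: x i).

Lemma mact_linear h : linear (act h). Proof. by case: hact. Qed.

Lemma mact_linearH a : linear (act^~ a). Proof. by case: hact => _ []. Qed.

Lemma mactM g h a : act (g * h) a = act g (act h a).
Proof. by case: hact => _ [_ []]. Qed.

Lemma mact1 a : act 1 a = a. Proof. by case: hact => _ [_ [_ []]]. Qed.

Lemma mact_mul h a b : act h (a * b) = sw (fun h1 h2 => act h1 a * act h2 b) h.
Proof. by case: hact => _ [_ [_ [_ []]]]. Qed.

Lemma mact_one h : act h 1 = counit h *: 1.
Proof. by case: hact => _ [_ [_ [_ []]]]. Qed.

(** Through this, identities between entries of [rho_V] are checked on vectors of A, so [rho_V]
    inherits linearity, multiplicativity and unit from [act]. *)
Lemma deg1_basis_free (c c' : 'I_N -> k) :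
  \sum_i c i *: x i = \sum_i c' i *: x i -> c =1 c'.
Proof.
move=> e i; case: hx => h1 h2.
have L1 : linear (@cg_pr k A 1) by case: A => ? ? ? [].
have [|c0 [_ c0U]] := h2 (\sum_i c i *: x i).
  by rewrite (lin_sum L1); apply: eq_bigr => j _; rewrite (linZ L1) h1.
have e1 : c0 = finfun c by apply: c0U; apply: eq_bigr => j _; rewrite ffunE.
have e2 : c0 = finfun c' by apply: c0U; rewrite e; apply: eq_bigr => j _; rewrite ffunE.
by have /ffunP/(_ i) := etrans (esym e1) e2; rewrite !ffunE.
Qed.

Lemma rhoV_linear i j : linear (fun h => rho_V h i j : k^o).
Proof.
move=> a u v.
apply: (@deg1_basis_free (fun i => rho_V (a *: u + v) i j)
  (fun i => a * rho_V u i j + rho_V v i j) _ i).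
rewrite -hV mact_linearH !hV scaler_sumr -big_split /=.
by apply: eq_bigr => l _; rewrite scalerDl scalerA.
Qed.

Lemma rhoV_mul g h i j : rho_V (g * h) i j = \sum_l rho_V g i l * rho_V h l j.
Proof.
apply: (@deg1_basis_free (fun i => rho_V (g * h) i j)
  (fun i => \sum_l rho_V g i l * rho_V h l j) _ i).
rewrite -hV mactM hV (lin_sum (mact_linear g)).
rewrite (eq_bigr (fun i => \sum_l rho_V h i j *: (rho_V g l i *: x l))) => [|l _]; last first.
  by rewrite (linZ (mact_linear g)) hV scaler_sumr.
rewrite exchange_big; apply: eq_bigr => l _; rewrite scaler_suml.
by apply: eq_bigr => l' _; rewrite scalerA mulrC.
Qed.

Lemma rhoV_one i j : rho_V 1 i j = (i == j)%:R.
Proof.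
apply: (@deg1_basis_free (fun i => rho_V 1 i j) (fun i => (i == j)%:R) _ i).
rewrite -hV mact1 (bigD1 j) //= eqxx scale1r big1 ?addr0 // => l /negPf->.
by rewrite scale0r.
Qed.

(* diag_entry with values in k instead of k^o, so that *: is over k. *)
Definition dcoef h t s : k := diag_entry rho_V h t s.

Local Notation D := dcoef.

Lemma diag_cons h a b t s :
  D h (a :: t) (b :: s) = sw (fun h1 h2 => rho_V h1 a b *: (D h2 t s : k^o)) h.
Proof. by []. Qed.

Lemma diag_linear t s : linear (fun h => D h t s : k^o).
Proof.
elim: t s => [|a t IH] [|b s]; try exact: linear_zero.
  exact: counit_linear.
by apply: sw_linear => u; apply: linear_scale_form; exact: rhoV_linear.
Qed.

(** Cutting a word in two regroups the iterated coproduct: coassociativity, by induction on the left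
    part. *)
Lemma diag_cat h t1 t2 s1 s2 : size t1 = size s1 ->
  D h (t1 ++ t2) (s1 ++ s2) = sw (fun a b => D a t1 s1 *: (D b t2 s2 : k^o)) h.
Proof.
elim: t1 s1 h => [|a t1 IH] [|b s1] h //.
  by move=> _; rewrite -[LHS](sw_counitl _ (diag_linear t2 s2)).
case=> e; rewrite !cat_cons diag_cons.
transitivity (sw (fun h1 h2 => sw (fun p q =>
    (rho_V h1 a b * D p t1 s1) *: (D q t2 s2 : k^o)) h2) h).
  apply: eq_sw_form => h1 h2; rewrite IH // (sw_comp _ _ (linear_scale _)).
  by apply: eq_sw => p q; rewrite scalerA.
rewrite -(sw_coassoc (gamma := fun p q r =>
    (rho_V p a b * D q t1 s1) *: (D r t2 s2 : k^o))).
- apply: eq_sw_form => h1 h2.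
  by rewrite diag_cons (sw_comp _ _ (linear_scalel _)).
- move=> q r; apply: linear_scale_form => c u v.
  by rewrite rhoV_linear mulrDl [in RHS]/GRing.scale /= mulrA.
- move=> p r; apply: linear_scale_form => c u v.
  by rewrite diag_linear mulrDr [in RHS]/GRing.scale /= mulrCA.
- by move=> p q; apply: linear_scalef; exact: diag_linear.
Qed.

Lemma diag_mul g h t s : size t = size s ->
  D (g * h) t s = \sum_(u : (size s).-tuple 'I_N) D g t u * D h u s.
Proof.
elim: t s g h => [|a t IH] [|b s] g h //.
  move=> _; rewrite (sum_tuple0 (fun u => D g [::] u * D h u [::])).
  exact: counitM.
case=> e; rewrite diag_cons swM; last first.
  split=> u; first by apply: linear_scale_form; exact: rhoV_linear.
  by apply: linear_scalef; exact: diag_linear.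
rewrite (sum_tuple_cons _ (fun u => D g (a :: t) u * D h u (b :: s))) /=.
pose E c u g1 g2 h1 h2 : k^o := (rho_V g1 a c * D g2 t u) * (rho_V h1 c b * D h2 u s).
transitivity (sw (fun g1 g2 => sw (fun h1 h2 =>
    \sum_c \sum_(u : (size s).-tuple 'I_N) E c u g1 g2 h1 h2) h) g).
  apply: eq_sw_form => g1 g2; apply: eq_sw => h1 h2.
  rewrite rhoV_mul IH // scaler_suml; apply: eq_bigr => c _.
  rewrite scaler_sumr; apply: eq_bigr => u _.
  exact: mulrACA.
transitivity (sw (fun g1 g2 => \sum_c \sum_(u : (size s).-tuple 'I_N)
    sw (E c u g1 g2) h) g).
  apply: eq_sw_form => g1 g2; rewrite sw_sum; apply: eq_bigr => c _.
  by rewrite sw_sum.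
rewrite sw_sum; apply: eq_bigr => c _; rewrite sw_sum; apply: eq_bigr => u _.
rewrite diag_cons (sw_comp _ _ (linear_mull (R := k^o) _)); apply: eq_sw_form => g1 g2.
by rewrite diag_cons (sw_comp _ _ (linear_mulr (R := k^o) _)).
Qed.

Lemma diag_one t s : size t = size s -> D 1 t s = (t == s)%:R.
Proof.
elim: t s => [|a t IH] [|b s] //; first by move=> _; exact: counit1.
case=> e; rewrite diag_cons sw1; last first.
  split=> u; first by apply: linear_scale_form; exact: rhoV_linear.
  by apply: linear_scalef; exact: diag_linear.
rewrite IH // rhoV_one eqseq_cons.
by case: (a == b); case: (t == s); rewrite ?scale0r ?scaler0 ?scale1r.
Qed.

(** Multiplication V^{(x) n} -> A is H-linear since A is a module algebra; this links the formal
    coefficients [diag_entry] to the action on A. *)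
Lemma act_wprod h s :
  act h (wprod x s) = \sum_(t : (size s).-tuple 'I_N) D h t s *: wprod x t.
Proof.
elim: s h => [|b s IH] h.
  by rewrite (sum_tuple0 (fun t => D h t [::] *: wprod x t)) /wprod big_nil mact_one.
rewrite /wprod big_cons -/(wprod x s) mact_mul.
rewrite (sum_tuple_cons _ (fun t => D h t (b :: s) *: wprod x t)).
transitivity (sw (fun h1 h2 => \sum_a \sum_(t : (size s).-tuple 'I_N)
    (rho_V h1 a b * D h2 t s) *: wprod x (a :: t)) h).
  apply: eq_sw => h1 h2; rewrite hV IH mulr_suml; apply: eq_bigr => a _.
  rewrite mulr_sumr; apply: eq_bigr => t _.
  by rewrite -scalerAl -scalerAr scalerA /wprod big_cons.
rewrite sw_sum; apply: eq_bigr => a _; rewrite sw_sum; apply: eq_bigr => t _.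
by rewrite diag_cons
  (sw_comp _ _ (linear_scalel _)).
Qed.

(** The diagonal action h (a (x) u) = h_(1) a (x) h_(2) u on A (x) V^{(x) n}. *)
Definition wact n (h : H) (F : tpow A N n) : tpow A N n :=
  [ffun t : n.-tuple 'I_N =>
     \sum_(s : n.-tuple 'I_N) sw (fun a b => D b t s *: act a (F s)) h].

Definition lmulF n (b : A) (F : tpow A N n) : tpow A N n := [ffun t => b * F t].

Definition ten n (g : tpow k^o N n) (a : A) : tpow A N n := [ffun t => g t *: a].

(** Multiplies the first p letters into the coefficient from A. With n = rho (i+1) and q = rho i, so
    p = n - q, this is [koszul_d]. *)
Definition contract p q n (F : tpow A N n) : tpow A N q :=
  [ffun t : q.-tuple 'I_N => \sum_(s : p.-tuple 'I_N) tcoef F (s ++ t) * wprod x s].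

Lemma ev_linear n (t : n.-tuple 'I_N) : linear (fun F : tpow A N n => F t).
Proof. by move=> a F G; rewrite !ffunE. Qed.

Let wact_term_linear n (t s : n.-tuple 'I_N) :
  (forall y, linear (fun a => D a t s *: (y : A))) /\
  (forall b a, linear (fun y => D b t s *: act a y)) /\
  (forall b y, linear (fun a => D b t s *: act a y)).
Proof.
split=> [y|]; first by apply: linear_scale_form; exact: diag_linear.
split=> [b a|b y]; apply: linear_scalef; [exact: mact_linear | exact: mact_linearH].
Qed.

Lemma wact_linear n h : linear (@wact n h).
Proof.
apply: linear_ffun => t; apply: linear_sumf => s; apply: linear_sw => a b.
have [_ [L _]] := wact_term_linear t s.
exact: linear_comp (L b a) (ev_linear s).
Qed.

Lemma wact_linearH n (F : tpow A N n) : linear (fun h => wact h F).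
Proof.
apply: linear_ffun => t; apply: linear_sumf => s; apply: sw_linear => u.
by have [_ [_ L]] := wact_term_linear t s; exact: L.
Qed.

Lemma tcoef_wact n h (F : tpow A N n) t : size t = n ->
  tcoef (wact h F) t =
  \sum_(s : n.-tuple 'I_N) sw (fun a b => D b t s *: act a (tcoef F s)) h.
Proof.
move/eqP=> ht; rewrite -[t]/(val (Tuple ht)) tcoef_tuple ffunE.
by apply: eq_bigr => s _; rewrite tcoef_tuple.
Qed.

Lemma wactM n g h (F : tpow A N n) : wact (g * h) F = wact g (wact h F).
Proof.
apply/ffunP=> t; rewrite !ffunE.
have L s := wact_term_linear t s.
pose E (u s : n.-tuple 'I_N) g1 g2 h1 h2 := (D g2 t u * D h2 u s) *: act g1 (act h1 (F s)).
transitivity (\sum_(s : n.-tuple 'I_N) \sum_(u : n.-tuple 'I_N)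
    sw (fun g1 g2 => sw (E u s g1 g2) h) g).
  apply: eq_bigr => s _; rewrite swM; last first.
    by have [L1 [_ L2]] := L s; split=> v; [exact: L2 | exact: L1].
  rewrite -sw_sum; apply: eq_sw => g1 g2; rewrite -sw_sum; apply: eq_sw => h1 h2.
  by rewrite diag_mul ?size_tuple // scaler_suml mactM.
rewrite exchange_big; apply: eq_bigr => u _.
rewrite -sw_sum; apply: eq_sw => g1 g2.
have [_ [/(_ g2 g1) Lu _]] := L u.
rewrite ffunE (lin_sum Lu); apply: eq_bigr => s _.
rewrite (sw_comp _ _ Lu); apply: eq_sw => h1 h2.
by rewrite (linZ (mact_linear g1)) scalerA.
Qed.

Lemma wact1 n (F : tpow A N n) : wact 1 F = F.
Proof.
apply/ffunP=> t; rewrite ffunE (bigD1 t) //= big1 ?addr0 => [|s ns].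
  rewrite sw1 ?diag_one ?eqxx ?scale1r ?mact1 //.
  by have [L1 [_ L2]] := wact_term_linear t t; split=> v; [exact: L2 | exact: L1].
rewrite sw1 ?diag_one ?size_tuple //; last first.
  by have [L1 [_ L2]] := wact_term_linear t s; split=> v; [exact: L2 | exact: L1].
by rewrite val_eqE eq_sym (negPf ns) scale0r.
Qed.

(** The relation between the H-action and left multiplication that makes A (x) V^{(x) n} an A #
    H-module. *)
Lemma wact_lmul n h b (F : tpow A N n) :
  wact h (lmulF b F) = sw (fun h1 h2 => lmulF (act h1 b) (wact h2 F)) h.
Proof.
apply/ffunP=> t; rewrite (sw_comp _ _ (ev_linear t)) ffunE.
transitivity (\sum_(s : n.-tuple 'I_N) sw (fun p q =>
    sw (fun q1 q2 => act p b * (D q2 t s *: act q1 (F s))) q) h); last first.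
  rewrite -sw_sum; apply: eq_sw => p q; rewrite !ffunE mulr_sumr.
  by apply: eq_bigr => s _; rewrite (sw_comp _ _ (linear_mulr _)).
have L s := wact_term_linear t s.
apply: eq_bigr => s _.
rewrite -(sw_coassoc (gamma := fun p1 p2 q => act p1 b * (D q t s *: act p2 (F s)))).
- apply: eq_sw => p q; rewrite ffunE mact_mul (sw_comp _ _ (linear_scale _)).
  by apply: eq_sw => p1 p2; rewrite scalerAr.
- by move=> p2 q; apply: linear_comp (linear_mull _) (mact_linearH b).
- by move=> p1 q; have [_ [_ L2]] := L s; exact: linear_comp (linear_mulr _) (L2 q (F s)).
- by move=> p1 p2; have [L1 _] := L s; exact: linear_comp (linear_mulr _) (L1 _).
Qed.

Lemma wact_ten n h (g : tpow k^o N n) a :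
  wact h (ten g a) = sw (fun p q => ten (diag_act rho_V q g) (act p a)) h.
Proof.
apply/ffunP=> t; rewrite (sw_comp _ _ (ev_linear t)) ffunE -sw_sum.
apply: eq_sw => p q; rewrite !ffunE scaler_suml; apply: eq_bigr => s _.
by rewrite ffunE (linZ (mact_linear p)) scalerA.
Qed.

(** Three Sweedler factors of h act on the coefficient, on the absorbed letters and on the remaining
    letters. The two sides group them as 1, (2, 3) and as (1, 2), 3. *)
Lemma wact_contract p q n h (F : tpow A N n) : (p + q)%N = n ->
  contract p q (wact h F) = wact h (contract p q F).
Proof.
move=> e; apply/ffunP=> t; rewrite !ffunE.
transitivity (\sum_(t' : q.-tuple 'I_N) \sum_(s' : p.-tuple 'I_N)
    sw (fun h1 h2 => sw (fun p1 p2 => D p2 t t' *: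
      (act h1 (tcoef F (s' ++ t')) * act p1 (wprod x s'))) h2) h).
  rewrite exchange_big /=.
  transitivity (\sum_(s : p.-tuple 'I_N) \sum_(s' : p.-tuple 'I_N) \sum_(t' : q.-tuple 'I_N)
    sw (fun h1 h2 => (D h2 (s ++ t) (s' ++ t') *: act h1 (tcoef F (s' ++ t'))) * wprod x s) h).
    apply: eq_bigr => s _; rewrite tcoef_wact ?size_cat ?size_tuple // mulr_suml.
    rewrite (sum_tuple_cat (fun u => sw (fun a b => D b (s ++ t) u *:
      act a (tcoef F u)) h * wprod x s) e).
    apply: eq_bigr => s' _; apply: eq_bigr => t' _.
    by rewrite (sw_comp _ _ (linear_mull _)).
  rewrite exchange_big; apply: eq_bigr => s' _.
  rewrite exchange_big; apply: eq_bigr => t' _.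
  rewrite -sw_sum; apply: eq_sw => h1 h2.
  transitivity (sw (fun p1 p2 => \sum_(s : p.-tuple 'I_N)
      D p2 t t' *: (act h1 (tcoef F (s' ++ t')) * (D p1 s s' *: wprod x s))) h2).
    rewrite sw_sum; apply: eq_bigr => s _.
    rewrite diag_cat ?size_tuple //.
    pose z := act h1 (tcoef F (s' ++ t')) * wprod x s.
    have zL : linear (fun c : k^o => @GRing.scale k _ c z).
      exact: (linear_scalel z).
    rewrite -scalerAl -/z (sw_comp _ _ zL); apply: eq_sw => p1 p2.
    by rewrite -scalerAr scalerA mulrC.
  apply: eq_sw => p1 p2; rewrite act_wprod size_tuple.
  by rewrite -scaler_sumr -mulr_sumr.
apply: eq_bigr => t' _; rewrite -sw_sum.
rewrite sw_sum -sw_sum.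
have L := wact_term_linear t t'.
transitivity (sw (fun h1 h2 => sw (fun p1 p2 => \sum_(s' : p.-tuple 'I_N) D h2 t t' *:
      (act p1 (tcoef F (s' ++ t')) * act p2 (wprod x s'))) h1) h).
  rewrite sw_sum (sw_coassoc (gamma := fun a b c => \sum_(s' : p.-tuple 'I_N) D c t t' *:
      (act a (tcoef F (s' ++ t')) * act b (wprod x s')))).
  - rewrite -sw_sum; apply: eq_sw => h1 h2; by rewrite sw_sum.
  - move=> b c; apply: linear_sumf => s'; apply: linear_scalef.
    exact: linear_comp (linear_mull _) (mact_linearH _).
  - move=> a c; apply: linear_sumf => s'; apply: linear_scalef.
    exact: linear_comp (linear_mulr _) (mact_linearH _).
  - move=> a b; apply: linear_sumf => s'; apply: linear_scale_form; exact: diag_linear.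
apply: eq_sw => h1 h2; rewrite ffunE (lin_sum (mact_linear _)) scaler_sumr sw_sum.
apply: eq_bigr => s' _; rewrite mact_mul.
by rewrite (sw_comp _ _ (linear_scale _)).
Qed.

Lemma diag_actE n h (F : tpow k^o N n) t :
  diag_act rho_V h F t = \sum_(s : n.-tuple 'I_N) D h t s * F s.
Proof. exact: ffunE. Qed.

Lemma diag_act_linear n h : linear (@diag_act k H N rho_V n h).
Proof.
apply: linear_ffun => t; apply: linear_sumf => s a F G.
by rewrite !ffunE mulrDr [D h t s * _]mulrCA.
Qed.

Lemma diag_act_linearH n (F : tpow k^o N n) : linear (fun h => diag_act rho_V h F).
Proof.
apply: linear_ffun => t; apply: linear_sumf => s.
by apply: linear_comp (linear_mull _) _; exact: diag_linear.
Qed.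

Lemma diag_actM n g h (F : tpow k^o N n) :
  diag_act rho_V (g * h) F = diag_act rho_V g (diag_act rho_V h F).
Proof.
apply/ffunP=> t; rewrite !diag_actE.
transitivity (\sum_(s : n.-tuple 'I_N) \sum_(u : n.-tuple 'I_N) D g t u * D h u s * F s).
  by apply: eq_bigr => s _; rewrite diag_mul ?size_tuple // mulr_suml.
rewrite exchange_big; apply: eq_bigr => u _; rewrite diag_actE mulr_sumr.
by apply: eq_bigr => s _; rewrite mulrA.
Qed.

Lemma diag_act1 n (F : tpow k^o N n) : diag_act rho_V 1 F = F.
Proof.
apply/ffunP=> t; rewrite diag_actE (bigD1 t) //= big1 ?addr0 => [|s ns].
  by rewrite diag_one // eqxx mul1r.
by rewrite diag_one ?size_tuple // val_eqE eq_sym (negPf ns) mul0r.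
Qed.

(** An evaluated slice of h F is a sum of images, under maps built from the H-action, of evaluated
    slices of [F] at outer words of the same lengths. *)
Lemma slice_diag_act m n h (F : tpow k^o N n) i j a b :
  (i + m + j)%N = n -> size a = i -> size b = j ->
  (forall a b, size a = i -> size b = j -> teval x (slice m F a b) = 0) ->
  teval x (slice m (diag_act rho_V h F) a b) = 0.
Proof.
move=> e ha hb hF.
(* The contribution of the outer words a', b' of [F] to the slice of h F at a, b: the first and last
   Sweedler factors give coefficients, the middle one acts on A through [act_wprod]. *)
pose Phi (a' b' : seq 'I_N) (y : A) := sw (fun h1 h2 => D h1 a a' *:
  sw (fun p q => D q b b' *: act p y) h2) h.
have PhiL a' b' : linear (Phi a' b').
  apply: linear_sw => h1 h2; apply: linear_scalef; apply: linear_sw => p q.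
  by apply: linear_scalef; exact: mact_linear.
have PhiE (a' : i.-tuple 'I_N) (b' : seq 'I_N) (c' : m.-tuple 'I_N) :
    size b = size b' ->
    \sum_(c : m.-tuple 'I_N) D h (a ++ c ++ b) (a' ++ c' ++ b') *: wprod x c =
    Phi a' b' (wprod x c').
  move=> hb'.
  transitivity (sw (fun h1 h2 => \sum_(c : m.-tuple 'I_N)
      (D h1 a a' *: sw (fun p q => D q b b' *: (D p c c' *: wprod x c)) h2)) h).
    rewrite sw_sum; apply: eq_bigr => c _.
    have zL : linear (fun c' : k^o => @GRing.scale k _ c' (wprod x c)).
      exact: (linear_scalel _).
    rewrite diag_cat ?size_tuple // (sw_comp _ _ zL); apply: eq_sw => h1 h2.
    rewrite diag_cat ?size_tuple // (linZ zL); congr (_ *: _).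
    rewrite (sw_comp _ _ zL); apply: eq_sw => p q.
    by rewrite scalerA mulrC.
  apply: eq_sw => h1 h2; rewrite -scaler_sumr; congr (_ *: _).
  rewrite -sw_sum; apply: eq_sw => p q.
  by rewrite -scaler_sumr act_wprod size_tuple.
rewrite /teval.
transitivity (\sum_(a' : i.-tuple 'I_N) \sum_(b' : j.-tuple 'I_N)
   Phi a' b' (teval x (slice m F a' b'))); last first.
  apply: big1 => a' _; apply: big1 => b' _.
  by rewrite hF ?size_tuple // (lin0 (PhiL _ _)).
transitivity (\sum_(c : m.-tuple 'I_N) \sum_(a' : i.-tuple 'I_N) \sum_(c' : m.-tuple 'I_N)
   \sum_(b' : j.-tuple 'I_N)
   tcoef F (a' ++ c' ++ b') *: (D h (a ++ c ++ b) (a' ++ c' ++ b') *: wprod x c)).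
  apply: eq_bigr => c _; rewrite ffunE.
  have hs : size (a ++ c ++ b) = n by rewrite !size_cat size_tuple ha hb addnA.
  rewrite (tcoef_ffun (fun t => \sum_(s : n.-tuple 'I_N) D h t s * F s)) //.
  rewrite (eq_bigr (fun s : n.-tuple 'I_N => D h (a ++ c ++ b) s * tcoef F s));
    last by move=> s _; rewrite tcoef_tuple.
  rewrite scaler_suml.
  rewrite (sum_tuple_cat (fun s => (D h (a ++ c ++ b) s * tcoef F s) *: wprod x c)
    (etrans (addnA _ _ _) e)).
  apply: eq_bigr => a' _.
  rewrite (sum_tuple_cat (fun s => (D h (a ++ c ++ b) (a' ++ s) * tcoef F (a' ++ s)) *: wprod x c)
    erefl).
  by apply: eq_bigr => c' _; apply: eq_bigr => b' _; rewrite scalerA mulrC.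
rewrite exchange_big; apply: eq_bigr => a' _.
rewrite exchange_big /=.
rewrite (eq_bigr (fun c' : m.-tuple 'I_N => \sum_(b' : j.-tuple 'I_N)
   tcoef F (a' ++ c' ++ b') *: Phi a' b' (wprod x c'))); last first.
  move=> c' _; rewrite exchange_big; apply: eq_bigr => b' _.
  by rewrite -scaler_sumr PhiE // size_tuple.
rewrite exchange_big; apply: eq_bigr => b' _.
rewrite /teval (lin_sum (PhiL _ _)); apply: eq_bigr => c' _.
by rewrite (linZ (PhiL _ _)) ffunE.
Qed.

End Action.

(** * Graded algebras and smash products *)

Section Gradings.
Context (k : fieldType) (I : eqType) (M : lmodType k) (pr : I -> M -> M).
Hypothesis prG : is_grading pr.

Lemma grading_linear i : linear (pr i). Proof. by case: prG. Qed.

Lemma grading_hom i j u : pr j u = u -> pr i u = if i == j then u else 0.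
Proof. by case: prG => _ o _ e; rewrite -{1}e o e. Qed.

Lemma grading_supp u (s : seq I) i :
  u = \sum_(j <- s) pr j u -> i \notin s -> pr i u = 0.
Proof.
case: prG => L o _ e ns; rewrite e (lin_sum (L i)) big_seq big1 // => j js.
by rewrite o; case: eqP => // ij; rewrite ij js in ns.
Qed.

Lemma grading_big u (s s' : seq I) :
  u = \sum_(j <- s) pr j u -> uniq s -> uniq s' -> {subset s <= s'} ->
  u = \sum_(j <- s') pr j u.
Proof.
move=> e us us' ss'; rewrite [LHS]e [RHS](bigID (mem s)) /= [X in _ + X]big1 ?addr0; last first.
  by move=> i; exact: (grading_supp e).
rewrite -[RHS]big_filter; apply: perm_big; apply: uniq_perm => //; first exact: filter_uniq.
by move=> i; rewrite mem_filter andb_idr //; exact: ss'.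
Qed.

End Gradings.

Lemma grading_ffun (k : fieldType) (I : eqType) (M : lmodType k) (pr : I -> M -> M)
    (J : finType) : is_grading pr ->
  is_grading (fun i (c : {ffun J -> M}) => [ffun j => pr i (c j)]).
Proof.
move=> prG; have [L o S] := prG; split.
- by move=> i; apply: linear_ffun => j a u v; rewrite !ffunE L.
- move=> i i' c; apply/ffunP=> j; rewrite !ffunE o.
  by case: eqP => _; rewrite ffunE.
move=> c.
have [s hs] : exists s : J -> seq I, forall j, uniq (s j) /\ c j = \sum_(i <- s j) pr i (c j).
  apply: (family_choice (Q := fun j (s : seq I) => uniq s /\ c j = \sum_(i <- s) pr i (c j))) => j.
  by have [s us e] := S (c j); exists s.
(* The union of the supports of the finitely many components; [grading_big] enlarges each sum to
   it. *)
exists (undup (flatten [seq s j | j <- enum J])); first exact: undup_uniq.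
apply/ffunP=> j; rewrite sum_ffunE.
under eq_bigr => i _ do rewrite ffunE.
have [us e] := hs j.
apply: (grading_big prG e us (undup_uniq _)) => i ij.
rewrite mem_undup; apply/flatten_mapP; exists j => //.
by rewrite mem_enum.
Qed.

Section GradedAlgebra.
Context (k : fieldType) (A : cgAlg k).

Lemma cg_grading : is_grading (@cg_pr k A). Proof. by case: A. Qed.

Lemma cg_prM i j (a b : A) :
  cg_pr i a = a -> cg_pr j b = b -> cg_pr (i + j)%N (a * b) = a * b.
Proof. by case: A a b => ? ? ? ? h ? ? a b; exact: h. Qed.

Lemma cg_pr1 : cg_pr 0%N 1 = 1 :> A. Proof. by case: A. Qed.

Lemma cg_pr0 (a : A) : cg_pr 0%N a = cg_aug a *: 1.
Proof. by case: A a => ? ? ? ? ? ? h a; exact: h. Qed.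

(** The grading of A extended by 0 to negative degrees, so that it can be shifted by integers. *)
Definition prz (z : int) (a : A) : A := if z is Posz n then cg_pr n a else 0.

Lemma prz_hom z i (a : A) : cg_pr i a = a -> prz z a = if z == i%:Z then a else 0.
Proof. by case: z => n h //=; exact: (grading_hom cg_grading). Qed.

Lemma prz_linear z : linear (prz z).
Proof. by case: z => n; [exact: grading_linear cg_grading n | exact: linear_zero]. Qed.

Lemma prz_grading : is_grading prz.
Proof.
have [L o S] := cg_grading; split; first exact: prz_linear.
  move=> [i|i] [j|j] a; [exact: o | exact: (lin0 (L i)) | by [] |].
  by rewrite /=; case: eqP.
move=> a; have [s us e] := S a; exists (map Posz s); last by rewrite big_map.
by rewrite map_inj_uniq // => i j [].
Qed.

Lemma cg_decomp (a : A) : exists s : seq nat, a = \sum_(i <- s) cg_pr i a.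
Proof. by have [_ _ /(_ a)[s _ e]] := cg_grading; exists s. Qed.

Lemma cg_pr_id i (a : A) : cg_pr i (cg_pr i a) = cg_pr i a.
Proof. by have [_ -> _] := cg_grading; rewrite eqxx. Qed.

Lemma prz_mulr z j (a b : A) : cg_pr j b = b -> prz (z + j%:Z) (a * b) = prz z a * b.
Proof.
move=> hb; have [s ->] := cg_decomp a.
rewrite mulr_suml !(lin_sum (prz_linear _)) mulr_suml; apply: eq_bigr => i _.
rewrite (prz_hom _ (cg_prM (cg_pr_id i a) hb)) (prz_hom _ (cg_pr_id i a)).
by rewrite PoszD (inj_eq (addIr _)); case: eqP => // _; rewrite mul0r.
Qed.

Lemma prz_mull z i (a b : A) : cg_pr i a = a -> prz (i%:Z + z) (a * b) = a * prz z b.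
Proof.
move=> ha; have [s ->] := cg_decomp b.
rewrite mulr_sumr !(lin_sum (prz_linear _)) mulr_sumr; apply: eq_bigr => j _.
rewrite (prz_hom _ (cg_prM ha (cg_pr_id j b))) (prz_hom _ (cg_pr_id j b)).
by rewrite PoszD (inj_eq (addrI _)); case: eqP => // _; rewrite mulr0.
Qed.

(** Every element is a finite sum of homogeneous ones, so degrees need only be tested on those. *)
Lemma prz_comm (V : lmodType k) (f : A -> V) (q : int -> V -> V) :
  linear f -> (forall z, linear (q z)) ->
  (forall i z a, cg_pr i a = a -> q z (f a) = if z == i%:Z then f a else 0) ->
  forall z a, q z (f a) = f (prz z a).
Proof.
move=> fL qL h z a; have [s ->] := cg_decomp a.
rewrite (lin_sum (prz_linear z)) !(lin_sum fL) (lin_sum (qL z)); apply: eq_bigr => i _.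
rewrite (h i) ?cg_pr_id // (prz_hom _ (cg_pr_id i a)).
by case: eqP => // _; rewrite (lin0 fL).
Qed.

Lemma scaler1_inj : injective (fun c : k => c *: (1 : A)).
Proof.
move=> c c' /eqP; rewrite -subr_eq0 -scalerBl scaler_eq0 oner_eq0 orbF subr_eq0.
by move/eqP.
Qed.

Lemma cg_aug_scalar : scalar (@cg_aug k A).
Proof.
move=> c a b; apply: scaler1_inj; rewrite -cg_pr0 (grading_linear cg_grading) !cg_pr0.
by rewrite scalerDl scalerA.
Qed.

Lemma cg_aug_linear : linear (@cg_aug k A : A -> k^o).
Proof. exact: cg_aug_scalar. Qed.

Lemma cg_aug1 : cg_aug (1 : A) = 1.
Proof. by apply: scaler1_inj; rewrite -cg_pr0 cg_pr1 scale1r. Qed.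

Lemma cg_aug_prz z (a : A) : cg_aug (prz z a) = if z == 0 then cg_aug a else 0.
Proof.
have [L o _] := cg_grading; apply: scaler1_inj; rewrite -cg_pr0.
case: z => n /=; last by rewrite (lin0 (L _)) scale0r.
rewrite o eqz_nat eq_sym; case: eqP => [->|_]; first by rewrite cg_pr0.
by rewrite scale0r.
Qed.

Lemma cg_aug_mul_hom j (a b : A) : cg_pr j b = b -> (0 < j)%N -> cg_aug (a * b) = 0.
Proof.
move=> hb hj; apply: scaler1_inj; rewrite -cg_pr0 scale0r.
rewrite -[cg_pr 0 _]/(prz 0%:Z _) -[0%:Z](subrK j%:Z) sub0r prz_mulr //.
by case: j hj {hb} => // j _; rewrite mul0r.
Qed.

Lemma cg_augM (a b : A) : cg_aug (a * b) = cg_aug a * cg_aug b.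
Proof.
have [s ->] := cg_decomp b.
rewrite mulr_sumr !(lin_sum cg_aug_linear) mulr_sumr; apply: eq_bigr => -[|j] _.
  rewrite cg_pr0 -scalerAr mulr1 !(linZ cg_aug_linear) cg_aug1.
  by rewrite [in LHS]/GRing.scale /= mulrC [_ *: 1]mulr1.
rewrite (cg_aug_mul_hom _ (cg_pr_id _ _)) //.
rewrite -[cg_pr _ _]mul1r (cg_aug_mul_hom _ (cg_pr_id _ _)) //.
by rewrite mulr0.
Qed.

Lemma wprod_hom N (x : 'I_N -> A) s : (forall i, cg_pr 1%N (x i) = x i) ->
  cg_pr (size s) (wprod x s) = wprod x s.
Proof.
move=> hx; rewrite /wprod; elim: s => [|i s IH]; first by rewrite big_nil cg_pr1.
by rewrite /= big_cons -add1n cg_prM.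
Qed.

End GradedAlgebra.

Section Smash.
Context (k : fieldType) (A : cgAlg k).
Context (H : hopfAlg k) (act : H -> A -> A) (hact : module_algebra act).
Context (hgr : graded_action act).

Lemma act_prz h z a : act h (prz z a) = prz z (act h a).
Proof.
symmetry; apply: (prz_comm (q := @prz k A)) => [|z'|i z' b hb].
- exact: mact_linear.
- exact: prz_linear.
- exact/prz_hom/hgr.
Qed.

(** The action preserves the degree 0 part, which is spanned by 1, and on 1 it is the counit. *)
Lemma cg_aug_act h a : cg_aug (act h a) = counit h * cg_aug a.
Proof.
apply: (@scaler1_inj k A); rewrite -cg_pr0 -[cg_pr _ _]/(prz 0%:Z _) -act_prz /= cg_pr0.
by rewrite (linZ (mact_linear hact h)) (mact_one hact) scalerA mulrC.
Qed.

Lemma smash_aug_linear : linear (@smash_aug k A H act : smash act -> k^o).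
Proof.
apply: tens_lift_linear => h c a b; rewrite cg_aug_scalar mulrDl.
by rewrite [in RHS]/GRing.scale /= mulrA.
Qed.

Lemma smash_aug_pure a h : smash_aug (pure a h : smash act) = cg_aug a * counit h.
Proof.
apply: (tens_lift_pure (Y := k^o)); split=> [u|b] c y z.
  by rewrite cg_aug_scalar mulrDl [in RHS]/GRing.scale /= mulrA.
by rewrite counit_scalar mulrDr [in RHS]/GRing.scale /= mulrCA.
Qed.

(** The augmentation turns the twist by h_(1) in the smash product into counit(h_(1)), which the
    counit axiom absorbs. *)
Lemma smash_augM (s t : smash act) : smash_aug (ra_mul s t) = smash_aug s * smash_aug t.
Proof.
have L := smash_aug_linear.
rewrite /= (tens_lift_comp _ _ L) [smash_aug s]/smash_aug.
rewrite (tens_lift_comp _ _ (linear_mull (R := k^o) _)).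
apply: eq_bigr => j _; move: (s j) (vbasis _)`_j => a h.
rewrite (tens_lift_comp _ _ L) [smash_aug t]/smash_aug.
rewrite (tens_lift_comp _ _ (linear_mulr (R := k^o) _)).
apply: eq_bigr => j' _; move: (t j') (vbasis _)`_j' => b g.
rewrite -/(sw _ h) (sw_comp _ _ L).
pose f (h' : H) : k^o := cg_aug a * cg_aug b * counit (g : H) * counit h'.
have fL : linear f.
  by move=> c u v; rewrite /f counit_scalar mulrDr [in RHS]/GRing.scale /= mulrCA.
transitivity (f h); last by rewrite /f -!mulrA; congr (_ * _); rewrite [RHS]mulrC -mulrA.
rewrite -(sw_counitl _ fL); apply: eq_sw_form => h1 h2.
rewrite smash_aug_pure cg_augM cg_aug_act counitM /f [in RHS]/GRing.scale /=.
rewrite -!mulrA mulrCA; congr (_ * _); congr (_ * _); congr (_ * _).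
by rewrite mulrC.
Qed.

Lemma smash_aug_one : smash_aug (ra_one (smash act)) = 1.
Proof. by rewrite smash_aug_pure cg_aug1 counit1 mulr1. Qed.

Lemma char_mod_is_mod (B : ralg k) (chi : B -> k) gr :
  scalar chi -> (forall b c, chi (ra_mul b c) = chi b * chi c) -> chi (ra_one B) = 1 ->
  (forall i b, (0 < i)%N -> ra_pr i b = b -> chi b = 0) ->
  is_mod gr (char_mod chi).
Proof.
move=> chiL chiM chi1 chi0; split.
- split=> [b|y] c u v /=; first by rewrite mulrDr [in RHS]/GRing.scale /= mulrCA.
  by rewrite chiL mulrDl [in RHS]/GRing.scale /= mulrA.
- by move=> b c y; rewrite /= chiM mulrA.
- by move=> y; rewrite /= chi1 mul1r.
move=> _; split; first split.
- by move=> i c u v /=; case: eqP => // _; rewrite scaler0 addr0.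
- move=> i j y /=; case: (eqVneq i j) => [->|nij]; first by case: eqP.
  by case: (eqVneq i 0) => // i0; case: (eqVneq j 0) => // j0; rewrite i0 j0 eqxx in nij.
- by move=> y; exists [:: 0] => //; rewrite big_seq1.
move=> i j b y hb /= hy; case: (eqVneq j 0) hy => [-> _|_ <-]; last by rewrite mulr0; case: eqP.
case: i hb => [|i] hb; first by rewrite eqxx.
by rewrite (chi0 i.+1) // mul0r; case: eqP.
Qed.

Lemma smash_char_is_mod gr : is_mod gr (char_mod (B := smash act) (smash_aug (act := act))).
Proof.
apply: char_mod_is_mod.
- exact: smash_aug_linear.
- exact: smash_augM.
- exact: smash_aug_one.
move=> i s hi hs; rewrite -hs; apply: big1 => j _.
rewrite ffunE -[cg_pr i _]/(prz i%:Z _) cg_aug_prz.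
by case: i hi {hs} => // i _; rewrite mul0r.
Qed.

Lemma alg_char_is_mod gr : is_mod gr (char_mod (B := alg_left A) (@cg_aug k A)).
Proof.
apply: char_mod_is_mod.
- exact: cg_aug_scalar.
- exact: cg_augM.
- exact: cg_aug1.
move=> i a hi ha; rewrite -ha -[ra_pr i _]/(prz i%:Z _) cg_aug_prz.
by case: i hi {ha}.
Qed.

Lemma pure_linearl (h : H) : linear (fun a : A => pure a h : smash act).
Proof. by case: (@pure_bilinear k A H) => L _; exact: L. Qed.

Definition smash_pure_mul (a : A) (h : H) (b : A) (g : H) : smash act :=
  sw (fun h1 h2 => pure (a * act h1 b) (h2 * g)) h.

Lemma smash_pure_mul_bilinear a h : bilinear2 (smash_pure_mul a h).
Proof.
have [pL pR] := @pure_bilinear k A H.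
split=> [g|b]; apply: linear_sw => h1 h2.
  by apply: linear_comp (pL _) (linear_comp (linear_mulr a) (mact_linear hact h1)).
exact: linear_comp (pR _) (linear_mulr h2).
Qed.

Lemma smash_mul_bilinear (t : smash act) :
  bilinear2 (fun a h => tens_lift (smash_pure_mul a h) t).
Proof.
have [pL pR] := @pure_bilinear k A H.
split=> [h|a]; apply: linear_sumf => j.
  by apply: linear_sw => h1 h2; apply: linear_comp (pL _) (linear_mull _).
apply: sw_linear => u.
by apply: linear_comp (pL _) (linear_comp (linear_mulr a) (mact_linearH hact _)).
Qed.

Lemma smash_mul_pure (a b : A) :
  ra_mul (pure a 1 : smash act) (pure b 1 : smash act) = pure (a * b) 1 :> smash act.
Proof.
have [pL pR] := @pure_bilinear k A H.
rewrite [LHS](tens_lift_pure _ _ (smash_mul_bilinear _)).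
rewrite (tens_lift_pure _ _ (smash_pure_mul_bilinear a 1)) /smash_pure_mul sw1.
  by rewrite (mact1 hact) mulr1.
split=> u; last exact: linear_comp (pR _) (linear_mull _).
by apply: linear_comp (pL _) (linear_comp (linear_mulr a) (mact_linearH hact _)).
Qed.

Lemma restrict_is_mod gr (M : rmod (smash act)) : is_mod gr M -> is_mod gr (restrict_alg M).
Proof.
case=> -[L1 L2] aM a1 grM; split.
- by split=> [b|y]; [exact: L1 | exact: linear_comp (L2 y) (pure_linearl _)].
- by move=> b c y; rewrite /= -aM smash_mul_pure.
- exact: a1.
move=> /grM[prG prA]; split=> // i j b y hb hy; apply: prA => //.
apply/ffunP=> l; rewrite !ffunE.
by rewrite (linZ (grading_linear (cg_grading A) i)) [X in _ *: X]hb.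
Qed.

(** Restriction keeps the spaces and the maps, so exactness carries over verbatim; the two
    augmentations agree on a # 1. *)
Lemma restrict_acyclic gr (P : chain (smash act)) (e : P 0%N -> k^o) :
  acyclic_over gr (M := char_mod (B := smash act) (smash_aug (act := act))) (Q := P) e ->
  acyclic_over gr (M := char_mod (B := alg_left A) (@cg_aug k A))
    (Q := restrict_chain P) e.
Proof.
case=> -[_ modP] [[eL eA eP] homP] sure exe exd; split=> //.
- by split=> [|i]; [exact: alg_char_is_mod | exact: restrict_is_mod].
- split=> [|i]; last first.
    by case: (homP i) => dL dA dP; split=> [|b y|]; [exact: dL | exact: dA | exact: dP].
  split; [exact: eL | | exact: eP] => a y.
  by rewrite eA /= smash_aug_pure counit1 mulr1.
Qed.

End Smash.

(** * The Koszul complex *)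

Section TensorSubspace.
Context (k : fieldType) (A : cgAlg k) (N n : nat) (U : {vspace tpow k^o N n}).

(** Identifies the free A-module on [vbasis U] with A (x) U inside A (x) V^{(x) n}. *)
Definition iota_sub (c : {ffun 'I_(\dim U) -> A}) : tpow A N n :=
  \sum_(j < \dim U) ten (vbasis U)`_j (c j).

Definition word_delta (t : n.-tuple 'I_N) : tpow k^o N n :=
  [ffun s : n.-tuple 'I_N => (s == t)%:R].

(** Coordinate forms of [U] are defined on all of V^{(x) n}; extended A-linearly, they give a left
    inverse of [iota_sub]. *)
Definition pi_sub (F : tpow A N n) : {ffun 'I_(\dim U) -> A} :=
  [ffun j => \sum_(t : n.-tuple 'I_N) coord (vbasis U) j (word_delta t) *: F t].

Lemma ten_linear (g : tpow k^o N n) : linear (@ten k A N n g).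
Proof. by apply: linear_ffun => t; exact: linear_scale. Qed.

Lemma ten_linearl (a : A) : linear (fun g : tpow k^o N n => ten g a).
Proof. by apply: linear_ffun => t c g h; rewrite !ffunE scalerDl scalerA. Qed.

Lemma iota_sub_linear : linear iota_sub.
Proof.
apply: linear_sumf => j; apply: linear_comp (ten_linear _) _ => c u v.
by rewrite !ffunE.
Qed.

Lemma iota_subE c t : iota_sub c t = \sum_(j < \dim U) (vbasis U)`_j t *: c j.
Proof. by rewrite sum_ffunE; apply: eq_bigr => j _; rewrite ffunE. Qed.

Lemma word_expand (g : tpow k^o N n) : g = \sum_t g t *: word_delta t.
Proof.
apply/ffunP=> s; rewrite sum_ffunE (bigD1 s) //= big1 ?addr0 => [|t nt].
  by rewrite !ffunE eqxx [RHS]mulr1.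
by rewrite !ffunE eq_sym (negPf nt) scaler0.
Qed.

Lemma iota_subK : cancel iota_sub pi_sub.
Proof.
move=> c; apply/ffunP=> j; rewrite ffunE.
transitivity (\sum_(l < \dim U) coord (vbasis U) j (vbasis U)`_l *: c l); last first.
  have fr : free (vbasis U) by apply: basis_free; exact: vbasisP.
  rewrite (bigD1 j) //= coord_free // eqxx scale1r big1 ?addr0 // => l nl.
  by rewrite coord_free // (negPf nl) scale0r.
rewrite (eq_bigr (fun t => \sum_(l < \dim U)
    ((vbasis U)`_l t * coord (vbasis U) j (word_delta t)) *: c l)).
  rewrite exchange_big; apply: eq_bigr => l _; rewrite -scaler_suml; congr (_ *: _).
  by rewrite [in RHS](word_expand (vbasis U)`_l) linear_sum; apply: eq_bigr => t _; rewrite linearZ.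
move=> t _; rewrite iota_subE scaler_sumr; apply: eq_bigr => l _.
by rewrite scalerA mulrC.
Qed.

Lemma iota_sub_inj : injective iota_sub. Proof. exact: can_inj iota_subK. Qed.

Definition in_sub (F : tpow A N n) : Prop := exists c, F = iota_sub c.

Lemma pi_subK F : in_sub F -> iota_sub (pi_sub F) = F.
Proof. by case=> c ->; rewrite iota_subK. Qed.

Lemma in_sub_iota c : in_sub (iota_sub c). Proof. by exists c. Qed.

Lemma in_sub_lin (c : k) F G : in_sub F -> in_sub G -> in_sub (c *: F + G).
Proof. by move=> [u ->] [v ->]; exists (c *: u + v); rewrite iota_sub_linear. Qed.

Lemma in_sub0 : in_sub 0.
Proof. by exists 0; rewrite (lin0 iota_sub_linear). Qed.

Lemma in_sub_sum I (r : seq I) (P : pred I) (F : I -> tpow A N n) :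
  (forall i, P i -> in_sub (F i)) -> in_sub (\sum_(i <- r | P i) F i).
Proof.
move=> h; apply: big_ind => //; first exact: in_sub0.
by move=> u v hu hv; rewrite -[u]scale1r; exact: in_sub_lin.
Qed.

Lemma in_sub_ten g a : g \in U -> in_sub (ten g a).
Proof.
move=> gU; exists [ffun j => coord (vbasis U) j g *: a].
rewrite {1}(coord_vbasis gU) (lin_sum (ten_linearl a)); apply: eq_bigr => j _.
by rewrite ffunE (linZ (ten_linearl a)) (linZ (ten_linear _)).
Qed.

Lemma in_sub_ind (Q : tpow A N n -> Prop) :
  Q 0 -> (forall F G, Q F -> Q G -> Q (F + G)) ->
  (forall g a, g \in U -> Q (ten g a)) -> forall F, in_sub F -> Q F.
Proof.
move=> Q0 QD Qt F [c ->]; apply: big_ind => // j _; apply: Qt.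
by apply: vbasis_mem; apply: mem_nth; rewrite size_tuple.
Qed.

Lemma lmulF_iota b c : lmulF b (iota_sub c) = iota_sub [ffun j => b * c j].
Proof.
apply/ffunP=> t; rewrite !ffunE !iota_subE mulr_sumr; apply: eq_bigr => j _.
by rewrite ffunE scalerAr.
Qed.

Definition map_word (f : A -> A) m (F : tpow A N m) : tpow A N m := [ffun t => f (F t)].

Lemma map_iota (f : A -> A) c :
  linear f -> map_word f (iota_sub c) = iota_sub [ffun j => f (c j)].
Proof.
move=> fL; apply/ffunP=> t; rewrite !ffunE !iota_subE (lin_sum fL); apply: eq_bigr => j _.
by rewrite ffunE (linZ fL).
Qed.

End TensorSubspace.

Section Rho.
Context (m : nat) (m_gt1 : (1 < m)%N).

Lemma rho0 : rho m 0 = 0%N. Proof. by rewrite /rho /= muln0. Qed.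

Lemma rhoSS i : rho m i.+2 = (rho m i + m)%N.
Proof. by rewrite /rho /= negbK mulnS; case: odd; [rewrite -addnA addnC | rewrite addnC]. Qed.

(** The step is 1 at even i and m - 1 at odd i, hence positive as m > 1. This strictness is the
    source of minimality. *)
Lemma rho_lt i : (rho m i < rho m i.+1)%N.
Proof.
rewrite /rho /= uphalf_half; case: odd; last by rewrite addn1.
by rewrite /= add1n mulnS addnC ltn_add2r.
Qed.

Lemma rho_le i : (rho m i <= rho m i.+1)%N. Proof. exact: ltnW (rho_lt i). Qed.

End Rho.

(** * The Koszul complex as a complex over the smash product *)

Section KoszulComplex.
Context (k : fieldType) (A : cgAlg k) (N : nat) (x : 'I_N -> A) (hx : deg1_basis x).
Context (m : nat) (m_gt1 : (1 < m)%N) (R : tpow k^o N m -> Prop).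
Context (hR : presents R x) (hexact : koszul_exact R x).
Context (H : hopfAlg k) (act : H -> A -> A) (hact : module_algebra act).
Context (hgr : graded_action act) (rho_V : H -> 'M[k]_N)
  (hV : forall h j, act h (x j) = \sum_i rho_V h i j *: x i).
Context (W : forall n, {vspace tpow k^o N n})
  (hW : forall n F, F \in W n <-> koszul_space R F).

Local Notation wact := (wact act rho_V).
Local Notation contract := (contract x).

Let x1 i : cg_pr 1%N (x i) = x i. Proof. by case: hx. Qed.

Lemma W_diag_act n h F : F \in W n -> diag_act rho_V h F \in W n.
Proof.
rewrite !hW !(koszul_spaceP hR) => hF i j a b e ha hb.
apply: (slice_diag_act hx hact hV _ e) => // a' b' ha' hb'.
exact: (hF i j).
Qed.

Lemma in_sub_wact n h (F : tpow A N n) : in_sub (W n) F -> in_sub (W n) (wact h F).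
Proof.
have L := wact_linear hx hact hV (n := n) h.
apply: (in_sub_ind (Q := fun F => in_sub (W n) (wact h F))) => [|F1 F2 h1 h2|g a gW].
- by rewrite (lin0 L); exact: in_sub0.
- by rewrite (linD L) -[wact h F1]scale1r; exact: in_sub_lin.
rewrite (wact_ten hact); apply: in_sub_sum => j _; apply: in_sub_ten.
exact: W_diag_act.
Qed.

Lemma lmulF_linear n (a : A) : linear (@lmulF k A N n a).
Proof. by apply: linear_ffun => t; exact: linear_comp (linear_mulr a) (@ev_linear k A N n t). Qed.

Lemma lmulF_linearl n (F : tpow A N n) : linear (fun a : A => lmulF a F).
Proof. by apply: linear_ffun => t; exact: linear_mull. Qed.

Definition sact n (s : smash act) (F : tpow A N n) : tpow A N n :=
  tens_lift (fun a h => lmulF a (wact h F)) s.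

Lemma sact_bilinear n (F : tpow A N n) :
  bilinear2 (fun a h => lmulF a (wact h F)).
Proof.
split=> [h|a]; first exact: lmulF_linearl.
exact: linear_comp (lmulF_linear a) (wact_linearH hx hact hV F).
Qed.

Lemma sact_linear n s : linear (@sact n s).
Proof.
apply: linear_sumf => j.
exact: linear_comp (lmulF_linear _) (wact_linear hx hact hV _).
Qed.

Lemma sact_linearl n (F : tpow A N n) : linear (fun s => sact s F).
Proof. by apply: tens_lift_linear; case: (sact_bilinear F). Qed.

Lemma sact_pure n a h (F : tpow A N n) : sact (pure a h : smash act) F = lmulF a (wact h F).
Proof. by rewrite /sact (tens_lift_pure _ _ (sact_bilinear F)). Qed.

Lemma sactM n s t (F : tpow A N n) : sact (ra_mul s t) F = sact s (sact t F).
Proof.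
have L := sact_linearl F.
rewrite /= (tens_lift_comp _ _ L); apply: eq_tens_lift => a h.
rewrite (tens_lift_comp _ _ L) [sact t F]/sact.
rewrite (tens_lift_comp _ _ (wact_linear hx hact hV h)) (tens_lift_comp _ _ (lmulF_linear a)).
apply: eq_tens_lift => b g.
rewrite -/(sw _ h) (sw_comp _ _ L) (wact_lmul hx hact hV) (sw_comp _ _ (lmulF_linear a)).
apply: eq_sw => h1 h2; rewrite sact_pure (wactM hx hact hV).
by apply/ffunP=> w; rewrite !ffunE mulrA.
Qed.

Lemma sact1 n (F : tpow A N n) : sact (ra_one (smash act)) F = F.
Proof.
rewrite sact_pure (wact1 hx hact hV).
by apply/ffunP=> t; rewrite ffunE mul1r.
Qed.

Lemma in_sub_sact n s (F : tpow A N n) : in_sub (W n) F -> in_sub (W n) (sact s F).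
Proof.
move=> hF; apply: in_sub_sum => j _.
have [c ->] := in_sub_wact (vbasis {:H})`_j hF.
by rewrite lmulF_iota; exact: in_sub_iota.
Qed.

Lemma wact_prz n h z (F : tpow A N n) :
  wact h (map_word (prz z) F) = map_word (prz z) (wact h F).
Proof.
apply/ffunP=> t; rewrite !ffunE (lin_sum (prz_linear z)); apply: eq_bigr => s _.
rewrite (sw_comp _ _ (prz_linear z)); apply: eq_sw => a b.
by rewrite ffunE (linZ (prz_linear z)) (act_prz hact hgr).
Qed.

Lemma contract_linear p q n : linear (@contract p q n).
Proof.
apply: linear_ffun => t; apply: linear_sumf => s.
exact: linear_comp (linear_mull _) (@tcoef_linear _ _ _ _ _).
Qed.

Lemma tcoef_map n (f : A -> A) (F : tpow A N n) s : linear f ->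
  tcoef (map_word f F) s = f (tcoef F s).
Proof.
move=> fL; rewrite /tcoef; case: insub => [t|]; first by rewrite ffunE.
by rewrite (lin0 fL).
Qed.

Lemma contract_lmul p q n a (F : tpow A N n) :
  contract p q (lmulF a F) = lmulF a (contract p q F).
Proof.
apply/ffunP=> t; rewrite !ffunE mulr_sumr; apply: eq_bigr => s _.
by rewrite -[lmulF a F]/(map_word ( *%R a) F) (tcoef_map _ _ (linear_mulr a)) mulrA.
Qed.

Lemma contract_sact p q n s (F : tpow A N n) : (p + q)%N = n ->
  contract p q (sact s F) = sact s (contract p q F).
Proof.
move=> e; rewrite (tens_lift_comp _ _ (@contract_linear p q n)).
apply: eq_tens_lift => a h.
by rewrite contract_lmul (wact_contract hx hact hV).
Qed.

Lemma contract_prz p q n z (F : tpow A N n) :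
  contract p q (map_word (prz z) F) = map_word (prz (z + p%:Z)) (contract p q F).
Proof.
apply/ffunP=> t; rewrite !ffunE (lin_sum (prz_linear _)); apply: eq_bigr => s _.
rewrite (tcoef_map _ _ (prz_linear z)) prz_mulr //.
by rewrite -{1}(size_tuple s); exact: wprod_hom.
Qed.

Lemma contract_ten p q n (g : tpow k^o N n) a :
  contract p q (ten g a) =
  \sum_(s : p.-tuple 'I_N) ten [ffun t : q.-tuple 'I_N => tcoef g (s ++ t)] (a * wprod x s).
Proof.
apply/ffunP=> t; rewrite sum_ffunE !ffunE; apply: eq_bigr => s _.
rewrite !ffunE /tcoef; case: insub => [u|]; first by rewrite ffunE scalerAl.
by rewrite mul0r scale0r.
Qed.

(** Dropping the first p letters of an element of W_n leaves elements of W_q: the condition on W_q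
    at position i is the one on W_n at position p + i. *)
Lemma in_sub_contract p q n (F : tpow A N n) : (p + q)%N = n ->
  in_sub (W n) F -> in_sub (W q) (contract p q F).
Proof.
move=> e.
apply: (in_sub_ind (Q := fun F => in_sub (W q) (contract p q F))) => [|F1 F2 h1 h2|g a gW].
- by rewrite (lin0 (@contract_linear p q n)); exact: in_sub0.
- rewrite (linD (@contract_linear p q n)) -[contract p q F1]scale1r.
  exact: in_sub_lin.
rewrite contract_ten; apply: in_sub_sum => s _; apply: in_sub_ten.
apply/hW/(koszul_spaceP hR) => i j u v e' hu hv.
have es : (p + i + m + j)%N = n by rewrite -e -e' !addnA.
have hsu : size (s ++ u) = (p + i)%N by rewrite size_cat size_tuple hu.
move/hW/(koszul_spaceP hR): gW => /(_ _ _ _ _ es hsu hv) <-.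
congr (teval x _); apply/ffunP=> c; rewrite !ffunE.
rewrite (tcoef_ffun (fun t => tcoef g (s ++ t))) -?catA //.
by rewrite !size_cat size_tuple hu hv addnA.
Qed.

Definition koszul_rank i := \dim (W (rho m i)).

Definition kiota i : {ffun 'I_(koszul_rank i) -> A} -> tpow A N (rho m i) :=
  @iota_sub k A N (rho m i) (W (rho m i)).

Definition kpi i : tpow A N (rho m i) -> {ffun 'I_(koszul_rank i) -> A} :=
  @pi_sub k A N (rho m i) (W (rho m i)).

(* A (x) W_(rho i), in coordinates on the basis vbasis of W_(rho i); the      *)
(* A # H-action is transported from A (x) V^{(x) rho i} along kiota.          *)
Definition koszul_mod i : rmod (smash act) :=
  @RMod k (smash act) {ffun 'I_(koszul_rank i) -> A}
    (fun s c => kpi (sact s (kiota c)))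
    (fun z c => [ffun j => prz (z - (rho m i)%:Z) (c j)]).

Lemma kiota_inj i : injective (@kiota i). Proof. exact: iota_sub_inj. Qed.

Lemma kiota_linear i : linear (@kiota i). Proof. exact: iota_sub_linear. Qed.

Lemma kiota_act i s (c : koszul_mod i) : kiota (rm_act s c) = sact s (kiota c).
Proof. by apply: pi_subK; apply: in_sub_sact; exact: in_sub_iota. Qed.

Lemma kiota_pr i z (c : koszul_mod i) :
  kiota (rm_pr z c) = map_word (prz (z - (rho m i)%:Z)) (kiota c).
Proof. by rewrite [RHS](map_iota _ (prz_linear _)). Qed.

Lemma koszul_mod_is_mod gr i : is_mod gr (koszul_mod i).
Proof.
have L := @kiota_linear i; split.
- split=> [s|c] a u v; apply: kiota_inj; rewrite L !kiota_act.
    by rewrite L sact_linear.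
  by rewrite sact_linearl.
- by move=> s t c; apply: kiota_inj; rewrite !kiota_act sactM.
- by move=> c; apply: kiota_inj; rewrite kiota_act sact1.
move=> _; split.
  have [pL pO pS] := grading_ffun 'I_(koszul_rank i) (prz_grading A); split.
  - by move=> z; exact: pL.
  - move=> z z' c; rewrite /= pO (inj_eq (addIr _)).
    by [].
  - move=> c; have [s us e] := pS c.
    exists [seq z + (rho m i)%:Z | z <- s]; first by rewrite map_inj_uniq // => z z' /addIr.
    by rewrite big_map {1}e; apply: eq_bigr => z _; rewrite /= addrK.
move=> j z s c hs hc; apply: kiota_inj.
rewrite kiota_pr kiota_act -{2}hc kiota_pr -addrA.
rewrite /sact /tens_lift.
apply/ffunP=> t; rewrite ffunE !sum_ffunE (lin_sum (prz_linear _)).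
apply: eq_bigr => l _; rewrite wact_prz !ffunE prz_mull //.
by move/ffunP/(_ l): hs; rewrite ffunE.
Qed.

Definition koszul_diff i (c : koszul_mod i.+1) : koszul_mod i :=
  kpi (koszul_d x (kiota c)).

Definition koszul_chain : chain (smash act) :=
  @Chain k (smash act) koszul_mod koszul_diff.

Let rhoE i : (rho m i.+1 - rho m i + rho m i)%N = rho m i.+1.
Proof. by rewrite subnK // rho_le. Qed.

Lemma kiota_diff i (c : koszul_mod i.+1) : kiota (koszul_diff c) = koszul_d x (kiota c).
Proof. by apply: pi_subK; apply: (in_sub_contract (rhoE i)); exact: in_sub_iota. Qed.

Lemma koszul_diff_hom gr i : is_hom gr (@koszul_diff i).
Proof.
split.
- move=> a u v; apply: kiota_inj; rewrite (@kiota_linear i) !kiota_diff (@kiota_linear i.+1).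
  exact: contract_linear.
- move=> s c; apply: kiota_inj; rewrite kiota_diff !kiota_act kiota_diff.
  exact: contract_sact (rhoE i).
move=> _ z c; apply: kiota_inj; rewrite kiota_diff !kiota_pr kiota_diff.
rewrite [LHS]contract_prz (_ : _ + _ = z - (rho m i)%:Z) //.
by rewrite -{1}(rhoE i) PoszD opprD addrA addrAC subrK.
Qed.

Lemma in_koszulP i (F : tpow A N (rho m i)) :
  in_koszul R F <-> in_sub (W (rho m i)) F.
Proof.
split=> [[n [a [g [gW ->]]]]|[c ->]].
  rewrite (_ : [ffun t => _] = \sum_j ten (g j) (a j)).
    by apply: in_sub_sum => j _; apply/in_sub_ten/hW.
  by apply/ffunP=> t; rewrite ffunE sum_ffunE; apply: eq_bigr => j _; rewrite ffunE.
exists (koszul_rank i), c, (fun j => (vbasis (W (rho m i)))`_j); split.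
  by move=> j; apply/hW/vbasis_mem/mem_nth; rewrite size_tuple.
by apply/ffunP=> t; rewrite ffunE iota_subE.
Qed.

Definition koszul_aug (c : koszul_mod 0) : k^o := cg_aug (tcoef (kiota c) [::]).

(** Two consecutive differentials absorb p1 + p2 = m letters, and the first m letters of an element
    of W_(rho (i+2)) form a relation of A. *)
Lemma koszul_diff_diff i (c : koszul_mod i.+2) : koszul_diff (koszul_diff c) = 0.
Proof.
apply: kiota_inj; rewrite !kiota_diff (lin0 (@kiota_linear i)).
set p1 := (rho m i.+2 - rho m i.+1)%N; set p2 := (rho m i.+1 - rho m i)%N.
rewrite -[LHS]/(contract p2 (rho m i) (contract p1 (rho m i.+1) (kiota c))).
have p12 : (p1 + p2)%N = m.
  by apply/eqP; rewrite -(eqn_add2r (rho m i)) -addnA !rhoE rhoSS addnC.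
have CL p q n := @contract_linear p q n.
rewrite (lin_sum (CL _ _ _)) (lin_sum (CL _ _ _)); apply: big1 => j _.
have : (vbasis (W (rho m i.+2)))`_j \in W (rho m i.+2).
  by apply/vbasis_mem/mem_nth; rewrite size_tuple.
move: (vbasis _)`_j (c j) => g a /hW/(koszul_spaceP hR) gW.
apply/ffunP=> t; rewrite !ffunE.
transitivity (a * teval x (slice m g [::] t)); last first.
  by rewrite (gW 0%N (rho m i)) ?mulr0 ?size_tuple // add0n rhoSS addnC.
rewrite /teval mulr_sumr.
transitivity (\sum_(s : m.-tuple 'I_N) a * (tcoef g (s ++ t) *: wprod x s)); last first.
  by apply: eq_bigr => s _; rewrite ffunE.
rewrite (sum_tuple_cat (fun s => a * (tcoef g (s ++ t) *: wprod x s)) p12) exchange_big /=.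
apply: eq_bigr => s2 _.
have h2 : size (s2 ++ t) == rho m i.+1 by rewrite size_cat !size_tuple rhoE.
rewrite -[s2 ++ t]/(val (Tuple h2)) tcoef_tuple ffunE mulr_suml; apply: eq_bigr => s1 _ /=.
have h1 : size (s1 ++ s2 ++ t) == rho m i.+2 by rewrite size_cat (eqP h2) size_tuple rhoE.
rewrite -catA -[s1 ++ _]/(val (Tuple h1)) !tcoef_tuple ffunE /wprod big_cat /=.
by rewrite -scalerAr -!scalerAl mulrA.
Qed.

Lemma koszul_aug_diff (c : koszul_mod 1) : koszul_aug (koszul_diff c) = 0.
Proof.
rewrite /koszul_aug kiota_diff.
have h : size (@nil 'I_N) == rho m 0 by rewrite rho0.
rewrite -[[::]]/(val (Tuple h)) tcoef_tuple ffunE (lin_sum (@cg_aug_linear k A)).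
apply: big1 => s _; rewrite (@cg_aug_mul_hom _ _ (size s)) //; first exact: wprod_hom.
by rewrite size_tuple subn_gt0 rho_lt.
Qed.

Lemma koszul_aug_hom gr :
  is_hom gr (N := char_mod (smash_aug (act := act))) koszul_aug.
Proof.
split.
- move=> a u v; rewrite /koszul_aug (@kiota_linear 0) tcoef_linear.
  exact: cg_aug_linear.
- move=> s c; rewrite /koszul_aug kiota_act (lin_sum (@tcoef_linear _ _ _ _ [::])).
  rewrite (lin_sum (@cg_aug_linear k A)) /= /smash_aug /tens_lift mulr_suml.
  apply: eq_bigr => j _.
  rewrite -[lmulF _ _]/(map_word ( *%R (s j)) _) (tcoef_map _ _ (linear_mulr _)) cg_augM.
  rewrite tcoef_wact ?rho0 // -mulrA; congr (_ * _).
  have sum0 (G : seq 'I_N -> A) : \sum_(t : (rho m 0).-tuple 'I_N) G t = G [::].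
    by rewrite rho0; exact: sum_tuple0.
  rewrite (sum0 (fun u => sw (fun a b => dcoef rho_V b [::] u *: act a (tcoef (kiota c) u)) _)).
  have e (a : A) g : sw (fun h1 h2 => dcoef rho_V h2 [::] [::] *: act h1 a) g = act g a.
    exact: sw_counitr g (mact_linearH hact a).
  by rewrite e (cg_aug_act hact hgr).
move=> _ z c; rewrite /koszul_aug kiota_pr (tcoef_map _ _ (prz_linear _)) cg_aug_prz.
by rewrite (_ : z - _ = z) //; rewrite rho0 subr0.
Qed.

Lemma koszul_acyclic gr : acyclic_over gr
  (M := char_mod (smash_aug (act := act))) (Q := koszul_chain) koszul_aug.
Proof.
split.
- by split=> [|i]; [exact: smash_char_is_mod | exact: koszul_mod_is_mod].
- by split=> [|i]; [exact: koszul_aug_hom | exact: koszul_diff_hom].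
(* The preimage is y tensor the empty word. It lies in A (x) W_0 because no i + m + j equals 0, so
   W_0 carries no condition. *)
- move=> y; pose F := @ten k A N (rho m 0) [ffun=> 1] ((y : k) *: 1).
  have hF : in_sub (W (rho m 0)) F.
    apply/in_sub_ten/hW => i j e; exfalso.
    by move: e m_gt1; rewrite rho0 => /eqP; rewrite !addn_eq0 => /andP[/andP[_ /eqP->]].
  exists (kpi F); rewrite /koszul_aug /kiota /kpi pi_subK //.
  have h : size (@nil 'I_N) == rho m 0 by rewrite rho0.
  rewrite -[[::]]/(val (Tuple h)) tcoef_tuple !ffunE scale1r.
  by rewrite (linZ (@cg_aug_linear k A)) cg_aug1 [LHS]mulr1.
- move=> c; split=> [e|[y ->]]; last exact: koszul_aug_diff.
  have [h1 _] := hexact; have [G /in_koszulP hG eG] := h1 _ e.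
  exists (kpi G); apply: kiota_inj; rewrite kiota_diff [in RHS]/kiota /kpi pi_subK //.
move=> i c; split=> [e|[y ->]]; last exact: koszul_diff_diff.
have [_ h2] := hexact; have [||G /in_koszulP hG eG] := h2 i (kiota c).
- by apply/in_koszulP; exact: in_sub_iota.
- by rewrite -kiota_diff [koszul_diff c]e (lin0 (@kiota_linear i)).
by exists (kpi G); apply: kiota_inj; rewrite kiota_diff [in RHS]/kiota /kpi pi_subK.
Qed.

Definition koszul_alg_chain : chain (alg_left A) := restrict_chain koszul_chain.

Lemma koszul_alg_acyclic gr : acyclic_over gr
  (M := char_mod (B := alg_left A) (@cg_aug k A)) (Q := koszul_alg_chain) koszul_aug.
Proof. exact: restrict_acyclic (koszul_acyclic gr). Qed.

Lemma koszul_actE i (a : A) (c : koszul_alg_chain i) : 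
  rm_act (a : alg_left A) c = [ffun j => a * c j].
Proof.
apply: kiota_inj; rewrite [LHS]kiota_act sact_pure (wact1 hx hact hV).
exact: lmulF_iota.
Qed.

Definition koszul_gen i (j : 'I_(koszul_rank i)) : koszul_alg_chain i :=
  [ffun l => (l == j)%:R].

Lemma koszul_expand i (c : koszul_alg_chain i) :
  c = \sum_j rm_act (c j : alg_left A) (koszul_gen j).
Proof.
rewrite (eq_bigr (fun j => [ffun l => c j * (l == j)%:R])); last first.
  by move=> j _; rewrite koszul_actE; apply/ffunP=> l; rewrite !ffunE.
apply/ffunP=> l; rewrite sum_ffunE (bigD1 l) //= big1 ?addr0 => [|j nj].
  by rewrite !ffunE eqxx mulr1.
by rewrite !ffunE eq_sym (negPf nj) mulr0.
Qed.

Lemma koszul_gen_pr i (j : 'I_(koszul_rank i)) :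
  rm_pr (rho m i)%:Z (koszul_gen j) = koszul_gen j.
Proof.
apply/ffunP=> l; rewrite !ffunE subrr.
by case: eqP => _; rewrite /= ?cg_pr1 // (lin0 (grading_linear (cg_grading A) _)).
Qed.

Definition koszul_free (M : rmod (alg_left A)) i (y : 'I_(koszul_rank i) -> M)
  (c : koszul_alg_chain i) : M := \sum_j rm_act (c j : alg_left A) (y j).

Lemma koszul_hom_expand (M : rmod (alg_left A)) gr i (f : koszul_alg_chain i -> M) c :
  is_hom gr f -> f c = koszul_free (fun j => f (koszul_gen j)) c.
Proof.
case=> fL fA _; rewrite {1}(koszul_expand c) (lin_sum fL).
by apply: eq_bigr => j _; rewrite fA.
Qed.

Lemma rm_pr_act (M : rmod (alg_left A)) (a : A) (y : M) (q z : int) :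
  is_mod true M -> rm_pr q y = y ->
  rm_pr z (rm_act (a : alg_left A) y) = rm_act (prz (z - q) a : alg_left A) y.
Proof.
move=> [[_ L2] _ _ /(_ isT)[prG prA]] hy.
rewrite -[z in LHS](subrK q).
apply: (prz_comm (f := fun a : A => rm_act (a : alg_left A) y)
  (q := fun z => rm_pr (z + q))) => [|z'|i z' b hb].
- exact: L2.
- exact: grading_linear prG _.
have hby := prA i q b y hb hy.
by rewrite (grading_hom prG _ hby) (inj_eq (addIr _)).
Qed.

Lemma koszul_free_hom (M : rmod (alg_left A)) gr i (y : 'I_(koszul_rank i) -> M) :
  is_mod gr M -> (gr -> forall j, rm_pr (rho m i)%:Z (y j) = y j) ->
  is_hom gr (koszul_free y).
Proof.
move=> modM hy; have [[L1 L2] aM a1 _] := modM; split.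
- by apply: linear_sumf => j a u v; rewrite !ffunE L2.
- move=> b c; rewrite /koszul_free (lin_sum (L1 b)); apply: eq_bigr => j _.
  by rewrite -aM koszul_actE ffunE.
case: gr modM hy => // modM hy _ z c; have [_ _ _ /(_ isT)[[prL _ _] _]] := modM.
rewrite /koszul_free (lin_sum (prL z)); apply: eq_bigr => j _.
by rewrite (rm_pr_act _ _ modM (hy isT j)) ffunE.
Qed.

Lemma koszul_projective gr i : projective gr (koszul_alg_chain i).
Proof.
move=> M T g f modM modT homg sg homf; have [gL gA gP] := homg.
have [y hy] : exists y : 'I_(koszul_rank i) -> M,
    forall j, g (y j) = f (koszul_gen j) /\ (gr -> rm_pr (rho m i)%:Z (y j) = y j).
  apply: (family_choice (Q := fun j y => g y = f (koszul_gen j) /\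
    (gr -> rm_pr (rho m i)%:Z y = y))) => j.
  have [y ey] := sg (f (koszul_gen j)).
  case: gr modM modT homg homf gP => modM modT homg homf gP; last by exists y.
  (* A preimage may be inhomogeneous, but its component of degree rho i has the same image, since
     the generator is homogeneous of that degree. *)
  exists (rm_pr (rho m i)%:Z y); have [_ _ fP] := homf; split.
    by rewrite gP // ey -fP // koszul_gen_pr.
  by move=> _; have [_ _ _ /(_ isT)[[_ -> _] _]] := modM; rewrite eqxx.
exists (koszul_free y).
  by apply: koszul_free_hom => // hg j; case: (hy j) => _; exact.
move=> c; rewrite (koszul_hom_expand c homf) /koszul_free (lin_sum gL).
by apply: eq_bigr => j _; rewrite gA; case: (hy j) => ->.
Qed.

(** Each coefficient of a boundary contains at least one letter of positive degree on the right, so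
    the augmentation kills it. *)
Lemma koszul_minimal j (g : koszul_alg_chain j -> k^o) :
  is_hom false (N := char_mod (B := alg_left A) (@cg_aug k A)) g ->
  forall c : koszul_alg_chain j.+1, g (ch_d c) = 0.
Proof.
move=> homg c; rewrite (koszul_hom_expand _ homg); apply: big1 => l _.
rewrite /= !ffunE (lin_sum (@cg_aug_linear k A)) big1 ?mul0r // => t _.
rewrite (linZ (@cg_aug_linear k A)) ffunE (lin_sum (@cg_aug_linear k A)) big1 ?scaler0 //.
move=> s _; rewrite (@cg_aug_mul_hom _ _ (size s)) //; first exact: wprod_hom.
by rewrite size_tuple subn_gt0 rho_lt.
Qed.

Lemma koszul_proj_res :
  is_proj_res true (char_mod (B := alg_left A) (@cg_aug k A)) koszul_alg_chain.
Proof.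
have [[_ modK] [home homd] sure exe exd] := koszul_alg_acyclic true.
split=> //; first by move=> i; split; [exact: modK | exact: koszul_projective].
by exists koszul_aug.
Qed.

Local Notation kA := (char_mod (B := alg_left A) (@cg_aug k A)).

Definition koszul_coord i (j : 'I_(koszul_rank i)) (c : koszul_alg_chain i) : k^o :=
  cg_aug (c j).

Lemma koszul_coord_hom i (j : 'I_(koszul_rank i)) :
  is_hom false (N := kA) (koszul_coord j).
Proof.
split=> // [a u v|b c]; first by rewrite /koszul_coord !ffunE cg_aug_linear.
by rewrite /koszul_coord koszul_actE ffunE cg_augM.
Qed.

Lemma koszul_coord_gen i (j l : 'I_(koszul_rank i)) :
  koszul_coord j (koszul_gen l) = (j == l)%:R.
Proof.
rewrite /koszul_coord ffunE; case: eqP => _; first by rewrite cg_aug1.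
exact: lin0 (@cg_aug_linear k A).
Qed.

Lemma koszul_pullback (P : chain (alg_left A)) (eP : P 0%N -> kA)
    (phi : forall i, P i -> koszul_alg_chain i) i (f : koszul_alg_chain i -> kA) :
  acyclic_over false eP ->
  (forall i, is_hom false (phi i)) -> (forall c, koszul_aug (phi 0%N c) = eP c) ->
  (forall i c, ch_d (phi i.+1 c) = phi i (ch_d c)) ->
  is_hom false f ->
  coboundary (P := P) (N := kA) (fun L g => is_hom false g) (fun c => f (phi i c)) ->
  forall c, f c = 0.
Proof.
move=> acP homphi ephi dphi homf cob.
apply: (@minimal_pullback k (alg_left A) false kA kA koszul_alg_chain P koszul_aug eP phi i f).
- exact: koszul_projective.
- exact: koszul_alg_acyclic.
- exact: acP.
- exact: homphi.
- exact: ephi.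
- exact: dphi.
- exact: koszul_minimal.
- exact: homf.
exact: cob.
Qed.

(** A coordinate form on W_(rho (d+1)) pulls back to 0 on a resolution of length d, so by minimality
    it is 0; yet it takes the value 1 on its generator. *)
Lemma koszul_rank_gt d : pdim_le kA d -> koszul_rank d.+1 = 0%N.
Proof.
move=> [P resP P0].
have [eP acP] := acyclic_of_res (alg_char_is_mod A false) resP.
have prP i : projective false (P i) by case: resP => h _ _ _; case: (h i).
have [phi [homphi ephi dphi]] := comparison prP acP (koszul_alg_acyclic false).
case E: (koszul_rank d.+1) => [//|r].
have j : 'I_(koszul_rank d.+1) by rewrite E; exact: ord0.
have cob : coboundary (P := P) (N := kA) (fun L g => is_hom false g)
    (fun c : P d.+1 => koszul_coord j (phi d.+1 c)).
  exists (fun=> 0); first by split=> // [a u v|b c]; rewrite ?scaler0 ?addr0 //= mulr0.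
  move=> c; have -> : c = 0 by exact: P0.
  have [pL _ _] := homphi d.+1.
  by rewrite (lin0 pL) /koszul_coord !ffunE (lin0 (@cg_aug_linear k A)).
have := koszul_pullback acP homphi ephi dphi (koszul_coord_hom j) cob (koszul_gen j).
by rewrite koszul_coord_gen eqxx => /eqP; rewrite oner_eq0.
Qed.

Local Notation isC n := (fun (M : rmod (alg_left A)) (f : M -> regular_mod (alg_left A)) =>
  is_hom_deg n f).

(** A cochain of degree - rho (i+1) on K_i would send generators to degree rho i - rho (i+1) < 0,
    where A is 0. *)
Lemma koszul_coboundary0 i (f : koszul_alg_chain i -> regular_mod (alg_left A)) :
  coboundary (P := koszul_alg_chain) (isC (- (rho m i)%:Z)) f -> forall c, f c = 0.
Proof.
case: i f => [|i] f //= [g [homg gP] e] c; rewrite e (koszul_hom_expand _ homg).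
apply: big1 => j _.
have -> : g (koszul_gen j) = 0.
  rewrite -koszul_gen_pr gP.
  have : ((rho m i)%:Z - (rho m i.+1)%:Z < 0 :> int)%R.
    by rewrite Num.Theory.subr_lt0 ltz_nat rho_lt.
  by case: (_ - _).
exact: mulr0.
Qed.

Lemma koszul_rank0_eq i (c : koszul_alg_chain i) : koszul_rank i = 0%N -> c = 0.
Proof. by move=> r0; apply/ffunP=> -[j hj]; exfalso; rewrite r0 in hj. Qed.

Definition koszul_proj i (j : 'I_(koszul_rank i)) (c : koszul_alg_chain i)
  : regular_mod (alg_left A) := c j.

(** The cocycle condition is empty when the next term of K vanishes. *)
Lemma koszul_proj_cocycle i (j : 'I_(koszul_rank i)) : koszul_rank i.+1 = 0%N ->
  cocycle (P := koszul_alg_chain) (isC (- (rho m i)%:Z)) (koszul_proj j).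
Proof.
move=> r0; split; first split; first split.
- by move=> a u v; rewrite /koszul_proj !ffunE.
- by move=> b c; rewrite /koszul_proj koszul_actE ffunE.
- by [].
- by move=> z c; rewrite /koszul_proj ffunE; case: (z - _).
move=> c; have [dL _ _] := koszul_diff_hom false i.
by rewrite (koszul_rank0_eq c r0) [ch_d _](lin0 dL) /koszul_proj ffunE.
Qed.

(* The cochains of degree - rho d on A (x) W_(rho d) are W_(rho d)^*, with no *)
(* nonzero coboundary among them, so this space is one-dimensional and        *)
(* - rho d is the degree - l of the only nonzero Ext.                         *)
Lemma koszul_rank_top d l : ext_gorenstein (B := alg_left A) (@cg_aug k A) d l ->
  koszul_rank d.+1 = 0%N -> rho m d = l /\ koszul_rank d = 1%N.
Proof.
move=> gor r0; have ext := gor _ koszul_proj_res d.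
(* If K_d were 0, every d-cochain would be 0, contradicting the nonzero class in degree - l. *)
have r_gt0 : (0 < koszul_rank d)%N.
  rewrite lt0n; apply/eqP => rd0.
  have := ext (- l%:Z); rewrite !eqxx /= => -[f0 [[[homf0 _] _] ncob _]].
  apply: ncob; have f00 c : f0 c = 0.
    by case: homf0 => fL _ _; rewrite (koszul_rank0_eq c rd0) (lin0 fL).
  case: d {ext gor r0 rd0} f0 homf0 f00 => [|i] f0 homf0 f00 //=.
  exists (fun=> 0) => //; split; first split=> //.
  - by move=> a u v; rewrite scaler0 addr0.
  - by move=> b c; rewrite /= mulr0.
  - move=> z c; symmetry; rewrite /=; case: (z + _) => n //.
    exact: lin0 (grading_linear (cg_grading A) n).
have projN0 (j : 'I_(koszul_rank d)) : koszul_proj j (koszul_gen j) != 0.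
  by rewrite /koszul_proj ffunE eqxx oner_eq0.
have := ext (- (rho m d)%:Z); rewrite eqxx /=.
(* If rho d differed from l, Ext^d would vanish in degree - rho d, and a nonzero cocycle would be a
   coboundary there. *)
case: eqP => [/oppr_inj[e]|_ zero]; last first.
  have := projN0 (Ordinal r_gt0).
  by rewrite (koszul_coboundary0 (zero _ (koszul_proj_cocycle _ r0))) eqxx.
move=> [f0 [_ _ f0P]]; split=> //; apply/eqP; rewrite eqn_leq r_gt0 andbT leqNgt.
apply/negP => r_gt1.
have key (j : 'I_(koszul_rank d)) : exists c : k, forall y, koszul_proj j y = c *: f0 y.
  have [c hc] := f0P _ (koszul_proj_cocycle j r0); exists c => y.
  by have /eqP := koszul_coboundary0 hc y; rewrite subr_eq0 => /eqP.
pose j0 := Ordinal r_gt0; pose j1 := Ordinal r_gt1.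
have [[c0 h0] [c1 h1]] := (key j0, key j1).
(* The form for [j1] vanishes on the generator [j0], so c1 = 0 or f0 is 0 at that generator; either
   way one of the two forms vanishes on its own generator. *)
have /eqP := h1 (koszul_gen j0); rewrite {1}/koszul_proj ffunE eq_sym scaler_eq0.
case/orP => /eqP h.
  by have := projN0 j1; rewrite h1 h scale0r eqxx.
by have := projN0 j0; rewrite h0 h scaler0 eqxx.
Qed.

(** * The top degree and the homological determinant *)

Section TopDegree.
Context (d : nat) (rank1 : koszul_rank d = 1%N) (w : tpow k^o N (rho m d)).
Context (wW : w \in W (rho m d)) (w_neq0 : w != 0).

Let top : 'I_(koszul_rank d) := cast_ord (esym rank1) ord0.

Let topE (j : 'I_(koszul_rank d)) : j = top.
Proof. by apply: val_inj; case: j => j; rewrite /= rank1 ltnS leqn0 => /eqP. Qed.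

Lemma top_line : W (rho m d) = <[w]>%VS.
Proof. by apply/esym/eqP; rewrite eqEdim -memvE wW dim_vline w_neq0 -/(koszul_rank d) rank1. Qed.

(** W_(rho d) is an H-stable line, and the eigenvalue on a nonzero vector is unique, so it inherits
    linearity and multiplicativity from the action. *)
Lemma top_character : exists lam : H -> k,
  is_character lam /\ forall h F, F \in W (rho m d) -> diag_act rho_V h F = lam h *: F.
Proof.
have [|lam hlam] := @family_choice H k (fun h c => diag_act rho_V h w = c *: w).
  by move=> h; have := W_diag_act h wW; rewrite top_line => /vlineP.
have inj (a b : k) : a *: w = b *: w -> a = b.
  move/eqP; rewrite -subr_eq0 -scalerBl scaler_eq0 (negPf w_neq0) orbF subr_eq0.
  by move/eqP.
exists lam; split; last first.
  move=> h F; rewrite top_line => /vlineP[c ->].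
  rewrite (linZ (diag_act_linear _ _)) hlam !scalerA.
  by rewrite mulrC.
split.
- move=> a u v; apply: inj; rewrite -hlam (diag_act_linearH hx hact hV) !hlam.
  by rewrite scalerDl scalerA.
- by apply: inj; rewrite -hlam (diag_act1 hx hact hV) scale1r.
move=> g h; apply: inj; rewrite -hlam (diag_actM hx hact hV) hlam.
rewrite (linZ (diag_act_linear _ _)) hlam scalerA.
by rewrite mulrC.
Qed.

(** h (a (x) b) = lam(h_(2)) (h_(1) a) (x) b, and the augmentation of h_(1) a is counit(h_(1)) times
    that of a; the counit axiom leaves lam(h). *)
Lemma top_coord_act (lam : H -> k) h (c : koszul_mod d) :
  is_character lam -> (forall h F, F \in W (rho m d) -> diag_act rho_V h F = lam h *: F) ->
  koszul_coord top (rm_act (pure (1 : A) h : smash act) c) = lam h * koszul_coord top c.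
Proof.
move=> lamC lamW; set b := (vbasis (W (rho m d)))`_top.
have bW : b \in W (rho m d) by apply/vbasis_mem/mem_nth; rewrite size_tuple.
have iotaE (c' : koszul_mod d) : kiota c' = ten b (c' top).
  rewrite /kiota /iota_sub (bigD1 top) //= big1 ?addr0 // => j.
  by rewrite (topE j) eqxx.
pose a' := sw (fun p q => lam q *: act p (c top)) h.
have -> : rm_act (pure (1 : A) h : smash act) c = [ffun=> a'].
  apply: kiota_inj; rewrite kiota_act sact_pure !iotaE ffunE (wact_ten hact).
  rewrite /a' (sw_comp _ _ (ten_linear _)).
  have -> F : lmulF 1 F = F :> tpow A N (rho m d) by apply/ffunP=> t; rewrite ffunE mul1r.
  apply: eq_sw => p q; rewrite lamW //.
  by rewrite (linZ (ten_linearl _)) (linZ (ten_linear _)).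
rewrite /koszul_coord ffunE (sw_comp _ _ (@cg_aug_linear k A)).
pose f (q : H) : k^o := lam q * cg_aug (c top).
have fL : linear f.
  by move=> z u v; rewrite /f (character_scalar lamC) mulrDl [in RHS]/GRing.scale /= mulrA.
transitivity (f h); last by [].
rewrite -(sw_counitl _ fL); apply: eq_sw => p q.
rewrite (linZ (@cg_aug_linear k A)) (cg_aug_act hact hgr) /f.
by rewrite [LHS]/GRing.scale [RHS]/GRing.scale /= mulrCA.
Qed.

Lemma top_hdet (hdet : H -> k) : is_hdet act d hdet ->
  forall h, diag_act rho_V h w = hdet h *: w.
Proof.
move=> [P resP [_ [eta etaP hdetE]]] h.
have [lam [lamC lamW]] := top_character.
have [eP acP] := acyclic_of_res (smash_char_is_mod hact hgr true) resP.
have prP i : projective true (P i) by case: resP => hP _ _ _; case: (hP i).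
have [phi [homphi ephi dphi]] := comparison prP acP (koszul_acyclic true).
(* The cochains in [is_hdet] are ungraded A-linear maps, so P is restricted to A and its grading
   forgotten. *)
have acPA : acyclic_over false (M := kA) (Q := restrict_chain P) eP.
  have [] := restrict_acyclic hact acP.
  move=> [modM modP] [homE homd] sure exe exd; split=> //.
  - by split=> [|i]; [exact: is_mod_false modM | exact: is_mod_false (modP i)].
  - by split=> [|i]; [exact: is_hom_false homE | exact: is_hom_false (homd i)].
have homphiA i : is_hom false (M := restrict_chain P i) (N := koszul_alg_chain i) (phi i).
  by have [pL pA _] := homphi i; split=> // b c; exact: pA.
have homcoord := koszul_coord_hom top.
have homf : is_hom false (M := restrict_chain P d) (N := kA)
    (fun y => koszul_coord top (phi d y)).
  exact: is_hom_comp homcoord (homphiA d).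
suff lamE g : lam (antip g) = eta g.
  by rewrite lamW // hdetE -lamE character_antip2.
have cocyc : cocycle (P := restrict_chain P)
    (fun (M : rmod (alg_left A)) (f : M -> kA) => is_hom false f)
    (fun y : P d => koszul_coord top (phi d y)).
  by split=> // y; rewrite -[ch_d y]/(@ch_d _ _ P d y) -dphi; exact: koszul_minimal.
have cob := etaP g _ cocyc.
(* H-linearity of phi turns the coboundary in [cob] into the pullback of this multiple of the
   coordinate form; minimality makes it 0, and so is its value lam(S(g)) - eta(g) on the
   generator. *)
pose g0 (c : koszul_alg_chain d) : kA := (lam (antip g) - eta g) * koszul_coord top c.
have homg0 : is_hom false g0.
  have [fL fA _] := homcoord; split=> //.
    exact: linear_comp (linear_mulr (R := k^o) _) fL.
  by move=> b c; rewrite /g0 fA /= mulrCA.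
have cob' : coboundary (P := restrict_chain P) (N := kA) (fun L f => is_hom false f)
    (fun y => g0 (phi d y)).
  apply: eq_coboundary cob => y; have [_ pA _] := homphi d.
  by rewrite pA (top_coord_act _ _ lamC lamW) -mulrBl.
have := koszul_pullback acPA homphiA ephi dphi homg0 cob' (koszul_gen top).
rewrite /g0 koszul_coord_gen eqxx mulr1 => /eqP.
by rewrite subr_eq0 => /eqP.
Qed.

End TopDegree.

End KoszulComplex.

(** * Superpotentials *)

Section Superpotential.
Context (k : fieldType) (A : cgAlg k) (N : nat) (x : 'I_N -> A).

Lemma ideal_deg_zero m (R : tpow k^o N m -> Prop) n (F : tpow k^o N n) :
  (forall r, R r -> r = 0) -> ideal_deg R F -> F = 0.
Proof.
move=> R0; move: F; apply: in_span_ind => // [c F G -> ->|F].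
  by rewrite scaler0 addr0.
case=> i [j [e [a [r [b [/R0 -> ->]]]]]].
have t0 p s : tcoef (0 : tpow k^o N p) s = 0 := lin0 (@tcoef_linear N k k^o p s).
apply: tpow_ext => s hs; rewrite t0 tcoef_tmul //.
have hd : size (drop i s) = (m + j)%N by rewrite size_drop hs -e -addnA addKn.
by rewrite tcoef_tmul // t0 mul0r mulr0.
Qed.

(** The twist in coordinates: all factors but the last are identities, so only the words u c
    survive, and theta reads off the coefficient of c u. *)
Lemma twist_coef l (w : tpow k^o N l) (sigma : 'M[k]_N) u y :
  tmap (fun i : 'I_l => if i.+1 == l then sigma else 1%:M) (theta w) = w ->
  (size u).+1 = l -> tcoef w (rcons u y) = \sum_c sigma y c * tcoef w (c :: u).
Proof.
case: l w => // l w ww [hu].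
have hs : size (rcons u y) == l.+1 by rewrite size_rcons hu.
rewrite -{1}ww -[rcons u y]/(val (Tuple hs)) tcoef_tuple ffunE.
pose f i := if i.+1 == l.+1 then sigma else 1%:M.
pose E (s : seq 'I_N) := (\prod_(i < l.+1) f i (nth y (rcons u y) i) (nth y s i)) *
  tcoef w (rotr 1 s).
rewrite (eq_bigr (fun s : l.+1.-tuple 'I_N => E s)); last first.
  move=> s _; rewrite ffunE /E -[rotr 1 s]/(val [tuple of rotr 1 s]) tcoef_tuple.
  by congr (_ * _); apply: eq_bigr => i _; rewrite !(tnth_nth y).
rewrite (sum_tuple_cat E (addn1 l)).
have hu' : size u == l by rewrite hu.
rewrite (bigD1 (Tuple hu')) //= [X in _ + X]big1 ?addr0 => [|v nv].
  rewrite (sum_tuple_cons _ (fun b => E (u ++ b))); apply: eq_bigr => c _.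
  rewrite (sum_tuple0 (fun b => E (u ++ c :: b))) /E cats1 rotr1_rcons.
  rewrite big_ord_recr /= !nth_rcons hu ltnn eqxx /f eqxx big1 ?mul1r // => i _.
  rewrite !nth_rcons hu ltn_ord ifN ?mxE ?eqxx //.
  by rewrite eqSS neq_ltn ltn_ord.
apply: big1 => b _; rewrite /E.
have [i ni] : exists i : 'I_l, nth y u i != nth y v i.
  apply/existsP; rewrite -negb_forall; apply: contra nv => /forallP h.
  apply/eqP/val_inj/(@eq_from_nth _ y) => /=; first by rewrite size_tuple.
  by move=> i; rewrite size_tuple => hi; rewrite (eqP (h (Ordinal hi))).
rewrite big_ord_recr (bigD1 i) //=.
rewrite nth_rcons hu ltn_ord nth_cat size_tuple ltn_ord /f ifN; last first.
  by rewrite eqSS neq_ltn ltn_ord.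
by rewrite mxE (negPf ni) !mul0r.
Qed.

Context (m l : nat) (w : tpow k^o N l) (hml : (m <= l)%N).
Context (hD : derivation_quotient x w (l - m)).

Lemma teval_partial a : size a = (l - m)%N -> teval x (slice m w a [::]) = 0.
Proof.
move/eqP=> ha.
have mE : (l - (l - m))%N = m by rewrite subKn.
have cast m' (E : seq 'I_N -> A) : m' = m ->
    \sum_(t : m.-tuple 'I_N) E t = \sum_(t : m'.-tuple 'I_N) E t by move=> ->.
rewrite /teval (eq_bigr (fun c : m.-tuple 'I_N => tcoef w (a ++ c) *: wprod x c)); last first.
  by move=> c _; rewrite ffunE cats0.
rewrite (cast _ (fun c => tcoef w (a ++ c) *: wprod x c) mE).
pose G : tpow k^o N (l - (l - m)) := [ffun t : (l - (l - m)).-tuple 'I_N =>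
  tcoef w (a ++ t)].
transitivity (teval x G); first by apply: eq_bigr => c _; rewrite ffunE.
have [_ ->] := hD; apply/ideal_deg_same/in_span_gen.
(* The forms psi_j are dual basis vectors picking the letters of [a], so this partial of [w] is its
   slice at [a]. *)
exists (fun j b => (tnth (Tuple ha) j == b)%:R); apply/ffunP=> t; rewrite !ffunE.
rewrite (bigD1 (Tuple ha)) //= big1 ?mul1r => [|j _]; last by rewrite eqxx.
rewrite big1 ?addr0 // => s ns.
have [j nj] : exists j, tnth (Tuple ha) j != tnth s j.
  apply/existsP; rewrite -negb_forall; apply: contra ns => /forallP h.
  by apply/eqP/eq_from_tnth => j; rewrite (eqP (h j)).
by rewrite (bigD1 j) //= (negPf nj) !mul0r.
Qed.

Hypothesis hw : twisted_superpotential w.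

(* Undoing the twist moves the last letter of w to the front, so a relation   *)
(* at the right end of w can be slid to any position.                         *)
Lemma superpotential_slices i j a b :
  (i + m + j)%N = l -> size a = i -> size b = j -> teval x (slice m w a b) = 0.
Proof.
elim/last_ind: b i j a => [|b y IH] i j a e ha hb.
  by apply: teval_partial; rewrite ha -e -hb addn0 addnK.
have [sigma _ hs] := hw.
case: j hb e => [|j]; rewrite size_rcons // => -[hb] e.
have {}e : (i.+1 + m + j)%N = l by rewrite -e addnS !addSn.
have coef := twist_coef (u := _) y hs.
transitivity (\sum_c sigma y c *: teval x (slice m w (c :: a) b)); last first.
  by apply: big1 => c _; rewrite (IH i.+1 j) ?scaler0 //= ha.
rewrite /teval; under [RHS]eq_bigr => c _ do rewrite scaler_sumr.
rewrite exchange_big; apply: eq_bigr => c _.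
rewrite ffunE -!rcons_cat coef ?scaler_suml; last first.
  by rewrite !size_cat size_tuple ha hb -e addnA !addSn.
by apply: eq_bigr => c' _; rewrite ffunE scalerA.
Qed.

(** If [w] were 0, all its partials would be 0 and A would have no relations. Evaluation in degree m
    would then be injective, so every slice of [F], and [F] itself, would be 0. *)
Lemma superpotential_neq0 : (exists2 F : tpow k^o N l,
    forall i j a b, (i + m + j)%N = l -> size a = i -> size b = j ->
      teval x (slice m F a b) = 0 & F != 0) -> w != 0.
Proof.
case=> F hF; apply: contra => /eqP w0; apply/eqP/tpow_ext => s hs.
have t0 p s' : tcoef (0 : tpow k^o N p) s' = 0 := lin0 (@tcoef_linear N k k^o p s').
have e : (0 + m + (l - m))%N = l by rewrite add0n subnKC.
have hd : size (drop m s) = (l - m)%N by rewrite size_drop hs.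
have := hF _ _ [::] _ e erefl hd; have [_ ->] := hD => hI.
have sl0 : slice m F [::] (drop m s) = 0.
  apply: (ideal_deg_zero _ hI) => r [psi ->]; apply/ffunP=> t; rewrite !ffunE.
  by apply: big1 => u _; rewrite w0 t0 mulr0.
have ht : size (take m s) == m by rewrite size_takel // hs.
have /ffunP/(_ (Tuple ht)) := sl0.
by rewrite !ffunE /= cat_take_drop t0.
Qed.

End Superpotential.

(** * The superpotential spans the top Koszul space *)

Theorem theorem1p1 (k : closedFieldType) (char0 : [pchar k] =i pred0)
    (* the algebra A, with x a basis of V = A_1 *)
    (A : cgAlg k) (m l d : nat) (hreg : AS_regular A d l) (hGK : gkdim_eq A d)
    (N : nat) (x : 'I_N -> A) (hx : deg1_basis x) (hKos : m_Koszul x m)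
    (* A = D(w, l - m) *)
    (w : tpow k^o N l) (hw : twisted_superpotential w)
    (hml : (m <= l)%N) (hD : derivation_quotient x w (l - m))
    (* the action of H, with rho_V h the matrix of h on V in the basis x *)
    (H : hopfAlg k) (hss : semisimple H)
    (act : H -> A -> A) (hact : module_algebra act) (hgr : graded_action act)
    (hinn : inner_faithful act)
    (rho_V : H -> 'M[k]_N) (hV : forall h j, act h (x j) = \sum_i rho_V h i j *: x i)
    (hdet : H -> k) (hhdet : is_hdet act d hdet) :
  (forall (h : H) (u : tpow k^o N l),
     u \in <[w]>%VS -> diag_act rho_V h u \in <[w]>%VS) /\
  (forall h : H, diag_act rho_V h w = hdet h *: w).
Proof.
have [m_gt1 [R [hR hexact]]] := hKos.
have [_ [[gor _] [[[gldim _] _] _]]] := hreg.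
pose W n := sval (constructive_indefinite_description _ (koszul_space_submod R n)).
have hW n F : F \in W n <-> koszul_space R F.
  exact: (svalP (constructive_indefinite_description _ (koszul_space_submod R n))).
have r0 : koszul_rank m W d.+1 = 0%N.
  have pd := gldim _ (alg_char_is_mod A false).
  exact: (koszul_rank_gt hx m_gt1 hR hexact hact hgr hV hW pd).
have [el rank1] := koszul_rank_top hx m_gt1 hR hexact hact hgr hV hW gor r0.
suff key : forall h, diag_act rho_V h w = hdet h *: w.
  split=> // h u /vlineP[c ->].
  by rewrite (linZ (diag_act_linear _ _)) key !memvZ ?memv_line.
subst l.
(* [w] and W come from two presentations of A, but the evaluations of slices in A are common to
   both. *)
have wW : w \in W (rho m d).
  apply/hW/(koszul_spaceP hR) => i j a b e ha hb.
  exact: (superpotential_slices hml hD hw e ha hb).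
have w_neq0 : w != 0.
  apply: (superpotential_neq0 hml hD).
  have [F FW F0] : exists2 F, F \in W (rho m d) & F != 0.
    exists (vpick (W (rho m d))); first exact: memv_pick.
    by rewrite vpick0 -dimv_eq0 -/(koszul_rank m W d) rank1.
  by exists F => //; apply/(koszul_spaceP hR)/hW.
exact: (top_hdet hx m_gt1 hR hexact hact hgr hV hW rank1 wW w_neq0 hhdet).
Qed.
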